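(* Let $(X,T)$ be the Delannoy adic dynamical system and let $\mu$ be any ergodic invariant Borel probability measure for it. Then $(X,T,\mu)$ is totally ergodic in the sense that no root of unity other than $1$ is an eigenvalue: if $\lambda\in\mathbb{C}$ is a root of unity and there is $f\in L^2(X,\mu)$, $f\neq 0$, with $f\circ T=\lambda f$ $\mu$-a.e., then $\lambda=1$.
   Context: **Delannoy graph.** The directed graph with vertex set $\mathbb{Z}_{\ge 0}^2$, root $R=(0,0)$, and, for every $(n,k)$, exactly one (horizontal) edge to $(n+1,k)$, one (vertical) edge to $(n,k+1)$ and one (diagonal) edge to $(n+1,k+1)$. The three edges entering a vertex $(n+1,k+1)$ with $n,k\ge 0$ are ordered so that the edge from $(n+1,k)$ is first, the diagonal edge from $(n,k)$ is second, and the edge from $(n,k+1)$ is last. **Path space.** $X$ is the set of infinite directed paths starting at $R$, with the compact metrizable topology generated by cylinder sets; a cylinder set is the set of all paths in $X$ that begin with a given finite path segment starting at $R$, and it is said to end at the terminal vertex of that segment. **Tail relation and adic transformation.** Two paths $x,y\in X$ are tail equivalent if there is a vertex through which both pass and after which they follow the same edges. For distinct tail equivalent $x,y$, let $w$ be the first such vertex; put $x<y$ if the edge by which $x$ enters $w$ precedes the edge by which $y$ enters $w$. $X_{\max}$ (resp. $X_{\min}$) is the set of paths all of whose edges are last (resp. first) among the edges entering their terminal vertices (the single edge entering a vertex on a coordinate axis counts as both first and last). The adic transformation $T:X\setminus X_{\max}\to X\setminus X_{\min}$ sends $x$ to the smallest $y$ with $y>x$; $T$ is extended to $X$ as the identity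 on $X_{\max}$. **Invariance and ergodicity.** A Borel probability measure $\mu$ on $X$ is invariant if any two cylinder sets ending at the same vertex have the same $\mu$-measure (i.e. $\mu$ is invariant under the tail relation). An invariant $\mu$ is ergodic if every Borel set that is a union of tail equivalence classes has $\mu$-measure $0$ or $1$. *)

(* Defs.v *)
From HB Require Import structures.
From mathcomp Require Import all_boot all_order all_algebra.
From mathcomp Require Import complex.
From mathcomp Require Import all_classical all_reals all_analysis.

Set Implicit Arguments.
Unset Strict Implicit.
Unset Printing Implicit Defensive.

Import Order.TTheory GRing.Theory Num.Theory.

Local Open Scope classical_set_scope.
Local Open Scope ring_scope.

Variant step := Hor | Diag | Ver.

(* The three edges entering (n+1, k+1) are ordered: the one from (n+1, k),
   then the one from (n, k), then the one from (n, k+1). *)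
Definition step_rank (s : step) : nat :=
  match s with
  | Ver => 0
  | Diag => 1
  | Hor => 2
  end.

Definition rank_step (i : nat) : step :=
  match i with
  | 0 => Ver
  | 1 => Diag
  | _ => Hor
  end.

Lemma step_rankK : cancel step_rank rank_step.
Proof. by case. Qed.

HB.instance Definition _ := Countable.copy step (can_type step_rankK).

Lemma step_enumP : Finite.axiom [:: Ver; Diag; Hor].
Proof. by case. Qed.

HB.instance Definition _ := fintype.isFinite.Build step step_enumP.
HB.instance Definition _ := isPointed.Build step Hor.

Definition vertex := (nat * nat)%type.

Definition move (v : vertex) (s : step) : vertex :=
  match s with
  | Hor => (v.1.+1, v.2)
  | Ver => (v.1, v.2.+1)
  | Diag => (v.1.+1, v.2.+1)
  end.

Definition end_vertex (s : seq step) : vertex := foldl move (0%N, 0%N) s.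

(* Every vertex has exactly one outgoing edge of each type, so an infinite
   path from the root is determined by its sequence of edge types; [x i] is the
   type of the edge from [path_vertex x i] to [path_vertex x i.+1]. *)
Definition delannoy_path := nat -> step.
HB.instance Definition _ := Pointed.copy delannoy_path (nat -> step).

Definition path_vertex (x : delannoy_path) (i : nat) : vertex :=
  end_vertex (mkseq x i).

Definition cylinder (s : seq step) : set delannoy_path :=
  [set x | mkseq x (size s) = s].

HB.instance Definition _ := isPointed.Build (seq step) [::].
HB.instance Definition _ :=
  isSubBaseTopological.Build delannoy_path [set: seq step] cylinder.

Notation delannoy_space := (g_sigma_algebraType (@open delannoy_path)).

(* [x] and [y] meet at a vertex, reached after [i] edges along [x] and [j]
   edges along [y] ([i] and [j] may differ because of the diagonal edges), and
   follow the same edges from there on. *)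
Definition merge_at (x y : delannoy_path) (i j : nat) : Prop :=
  path_vertex x i = path_vertex y j /\
  forall m, x (i + m)%N = y (j + m)%N.

Definition tail_equivalent (x y : delannoy_path) : Prop :=
  exists i j, merge_at x y i j.

(* If the first merging vertex is the root then [x = y]; the indices [i.+1] and
   [j.+1] thus encode that [x] and [y] are distinct. *)
Definition path_lt (x y : delannoy_path) : Prop :=
  exists i j, [/\ merge_at x y i.+1 j.+1,
    forall i' j', merge_at x y i' j' -> (i < i')%N && (j < j')%N &
    (step_rank (x i) < step_rank (y j))%N].

Definition enters (s : step) (v : vertex) : Prop :=
  exists u : vertex, move u s = v.

Definition last_edge (s : step) (v : vertex) : Prop :=
  enters s v /\ forall s', enters s' v -> (step_rank s' <= step_rank s)%N.

Definition path_max : set delannoy_path :=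
  [set x | forall i, last_edge (x i) (path_vertex x i.+1)].

Definition is_successor (x y : delannoy_path) : Prop :=
  path_lt x y /\ forall z, path_lt x z -> z = y \/ path_lt y z.

Definition adic (x : delannoy_path) : delannoy_path :=
  if `[< path_max x >] then x else xget x [set y | is_successor x y].

Section measures.
Context {R : realType}.
Implicit Type mu : probability delannoy_space R.

Definition tail_invariant mu : Prop :=
  forall s t : seq step, end_vertex s = end_vertex t ->
    mu (cylinder s) = mu (cylinder t).

Definition tail_saturated (A : set delannoy_space) : Prop :=
  forall x y, tail_equivalent x y -> A x -> A y.

Definition tail_ergodic mu : Prop :=
  forall A : set delannoy_space, measurable A -> tail_saturated A ->
    mu A = 0%E \/ mu A = 1%E.

Definition complex_L2 mu (f : delannoy_space -> R[i]) : Prop :=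
  [/\ measurable_fun setT (fun x => complex.Re (f x)),
      measurable_fun setT (fun x => complex.Im (f x)) &
      finite_norm mu 2%:E (fun x => ComplexField.Normc.normc (f x))].

Definition adic_eigenvalue mu (lambda : R[i]) : Prop :=
  exists f : delannoy_space -> R[i],
    [/\ complex_L2 mu f,
        ~ {ae mu, forall x, f x = 0} &
        {ae mu, forall x, f (adic x) = lambda * f x}].

Definition totally_ergodic mu : Prop :=
  forall lambda : R[i],
    (exists2 n : nat, (0 < n)%N & lambda ^+ n = 1) ->
    adic_eigenvalue mu lambda -> lambda = 1.

End measures.

(* Main.v *)
Require Import Defs.
From mathcomp Require Import all_boot all_order all_algebra.
From mathcomp Require Import finmap complex.
From mathcomp Require Import all_classical all_reals all_analysis.
From mathcomp Require Import measurable_realfun zify lra.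

(** Let [f] be a nonzero eigenfunction for a root of unity [lambda <> 1], and
    let [p] be a prime dividing the order of [lambda].

    The number of steps of the transformation between two tail equivalent
    paths can be computed.  If [t] is a path segment from the root to [v], then the path
    [t . Diag . y] is reached from [t . Hor . Ver . y] by applying the adic
    transformation [delannoy v.1 v.2] times, where [delannoy n k] is the number
    of paths from the root to [(n, k)].  Therefore
      [f (t . Diag . y) = lambda ^+ delannoy v.1 v.2 * f (t . Hor . Ver . y)]
    ([eigen_Diag]).  Now in the columns [n = p ^ j - 1] no Delannoy number is
    divisible by [p] ([delannoy_predpexp]): there the replacement of the edge
    [Diag] by the two edges [Hor], [Ver] changes the value of [f].

    On the other hand, such a replacement preserves the measure, by tail
    invariance, and it leaves the first [n] edges alone if it is made when the
    path first hits column [n].  As a measurable set is approximated by sets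
    that depend on finitely many edges, the value of [f] is hardly changed if
    [n] is large.  Hence the probability that the path leaves column [n] by a
    diagonal edge when it first hits it tends to [0] along [n = p ^ j - 1].
    Tail invariance also implies that the edges are exchangeable, since the
    endpoint of a path segment does not depend on the order of its edges; so
    this probability is the one of the event that the first edge is diagonal,
    provided that almost every path hits every column ([mu_Diag_le_hit],
    [mu_Diag_small]).

    Thus almost no path has a diagonal edge.  As [Diag], [Hor . Ver] and
    [Ver . Hor] end at the same vertex, almost every path is constant
    ([Diag_null_const]).  But the two constant paths are fixed by the
    transformation, so that [f] vanishes there, whereas by ergodicity [f] is
    almost everywhere nonzero.

    To make precise that [f] changes, it is enough to look at the finitely
    many sets [B m] of the paths [x] for which [lambda ^+ m * f x] is the
    lexicographically largest of all [lambda ^+ l * f x]: two paths of [B m]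
    whose values differ by a power of [lambda] have the same value. *)

Set Implicit Arguments.
Unset Strict Implicit.
Unset Printing Implicit Defensive.

Import Order.TTheory GRing.Theory Num.Theory.

Local Open Scope classical_set_scope.
Local Open Scope ring_scope.

(** * Concatenation of a path segment and a path *)

(** The path that follows the edges of [s] and then those of [y]; the default
    value of [nth] is never used. *)
Definition path_cat (s : seq step) (y : delannoy_path) : delannoy_path :=
  fun i => if (i < size s)%N then nth Hor s i else y (i - size s)%N.

(** The path without its first [n] edges, read as a path from the root. *)
Definition path_drop (n : nat) (x : delannoy_path) : delannoy_path :=
  fun i => x (n + i)%N.

Lemma path_cat_cat s t y : path_cat (s ++ t) y = path_cat s (path_cat t y).
Proof.
apply: funext => i; rewrite /path_cat size_cat nth_cat.
have [i_s|s_i] := ltnP i (size s); first by rewrite ltn_addr.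
by rewrite -ltn_subLR // subnDA.
Qed.

Lemma path_cat_rcons s a y : path_cat (rcons s a) y = path_cat s (path_cat [:: a] y).
Proof. by rewrite -cats1 path_cat_cat. Qed.

Lemma path_catK s y : path_drop (size s) (path_cat s y) = y.
Proof.
by apply: funext => i; rewrite /path_drop /path_cat ltnNge leq_addr /= addKn.
Qed.

Lemma path_catE s y i : path_cat s y (size s + i)%N = y i.
Proof. by rewrite -[RHS](congr1 (fun x => x i) (path_catK s y)). Qed.

Lemma path_cat_size s a y : path_cat (rcons s a) y (size s) = a.
Proof. by rewrite /path_cat size_rcons ltnSn nth_rcons ltnn eqxx. Qed.

Lemma mkseq_cat (x : delannoy_path) m n :
  mkseq x (m + n) = mkseq x m ++ mkseq (path_drop m x) n.
Proof.
rewrite /mkseq iotaD map_cat; congr cat; rewrite add0n.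
by rewrite -[m in iota m n]addn0 iotaDl -map_comp.
Qed.

Lemma mkseq_path_cat s y : mkseq (path_cat s y) (size s) = s.
Proof.
apply: (@eq_from_nth _ Hor) => [|i]; rewrite size_mkseq // => i_s.
by rewrite nth_mkseq // /path_cat i_s.
Qed.

Lemma cylinder_cat s y : cylinder s (path_cat s y).
Proof. exact: mkseq_path_cat. Qed.

Lemma path_cat_mkseq x n : path_cat (mkseq x n) (path_drop n x) = x.
Proof.
apply: funext => i; rewrite /path_cat size_mkseq /path_drop.
by have [i_n|n_i] := ltnP i n; [rewrite nth_mkseq | rewrite subnKC].
Qed.

Lemma cylinder_catE s x :
  cylinder s x -> path_cat s (path_drop (size s) x) = x.
Proof. by rewrite /cylinder /= => {1}<-; rewrite path_cat_mkseq. Qed.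

Lemma path_cat_inj s y z : path_cat s y = path_cat s z -> y = z.
Proof. by move=> eq_yz; rewrite -(path_catK s y) eq_yz path_catK. Qed.

(** * Vertices *)

Lemma foldl_move (v : vertex) s :
  foldl move v s = (v.1 + (end_vertex s).1, v.2 + (end_vertex s).2)%N.
Proof.
rewrite /end_vertex; elim/last_ind: s => [|s a IHs]; first by rewrite /= !addn0; case: v.
rewrite !foldl_rcons IHs.
by case: a => /=; rewrite ?addnS.
Qed.

Lemma end_vertex_cat s t : end_vertex (s ++ t) =
  ((end_vertex s).1 + (end_vertex t).1, (end_vertex s).2 + (end_vertex t).2)%N.
Proof. by rewrite [LHS]foldl_cat foldl_move. Qed.

Lemma end_vertex_rcons s a : end_vertex (rcons s a) = move (end_vertex s) a.
Proof. exact: foldl_rcons. Qed.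

Lemma end_vertex_catC s t : end_vertex (s ++ t) = end_vertex (t ++ s).
Proof. by rewrite !end_vertex_cat addnC [X in (_, X)]addnC. Qed.

Lemma path_vertex_cat s y : path_vertex (path_cat s y) (size s) = end_vertex s.
Proof. by rewrite /path_vertex mkseq_path_cat. Qed.

Lemma path_vertexS x i : path_vertex x i.+1 = move (path_vertex x i) (x i).
Proof.
by rewrite /path_vertex mkseqS end_vertex_rcons.
Qed.

Lemma path_vertex_lt x i j : (i < j)%N ->
  ((path_vertex x i).1 + (path_vertex x i).2 <
   (path_vertex x j).1 + (path_vertex x j).2)%N.
Proof.
elim: j => // j IHj; rewrite ltnS leq_eqVlt => /orP[/eqP->|/IHj].
  by rewrite path_vertexS; case: (x j) => /=; lia.
by rewrite path_vertexS; case: (x j) => /=; lia.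
Qed.

Lemma path_vertex_inj x : injective (path_vertex x).
Proof.
move=> i j eq_ij; have [ij|ji|//] := ltngtP i j.
  by have := path_vertex_lt x ij; rewrite eq_ij ltnn.
by have := path_vertex_lt x ji; rewrite eq_ij ltnn.
Qed.

(** * Tail relation and order *)

Lemma merge_atD x y i j m : merge_at x y i j -> merge_at x y (i + m) (j + m).
Proof.
move=> [v_ij e_ij]; split; last by move=> l; rewrite -!addnA e_ij.
elim: m => [|m IHm]; rewrite ?addn0 // !addnS !path_vertexS IHm.
by rewrite e_ij.
Qed.

Lemma merge_at_sym x y i j : merge_at x y i j -> merge_at y x j i.
Proof. by case=> v e; split=> // m; rewrite e. Qed.

Lemma merge_at_le x y i j i' j' : merge_at x y i j -> merge_at x y i' j' ->
  (i' <= i)%N -> (i - i' = j - j')%N /\ (j' <= j)%N.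
Proof.
move=> [v_ij _] m' le_i; have [] := merge_atD (i - i') m'.
rewrite subnKC // v_ij => /path_vertex_inj -> _; lia.
Qed.

(** The minimality clause of [path_lt] is automatic: paths that merge at
    distinct edges cannot have merged before. *)
Lemma path_lt_intro x y i j : merge_at x y i.+1 j.+1 ->
  (step_rank (x i) < step_rank (y j))%N -> path_lt x y.
Proof.
move=> m_ij lt_ij; exists i, j; split=> // i' j' m'.
have ne i0 : (i' <= i)%N -> i = (i' + i0)%N -> j = (j' + i0)%N -> False.
  by case: m' => _ e _ ei ej; move: lt_ij; rewrite ei ej e ltnn.
rewrite ltnNge [(j < j')%N]ltnNge; apply/andP; split; apply/negP => le.
  have [|e1 e2] := merge_at_le m_ij m'; first lia.
  by apply: (ne (i - i')%N); lia.
have [|e1 e2] := merge_at_le (merge_at_sym m_ij) (merge_at_sym m'); first lia.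
by apply: (ne (i - i')%N); lia.
Qed.

Lemma path_lt_asym x y : path_lt x y -> ~ path_lt y x.
Proof.
move=> [i [j [m_ij min_ij lt_ij]]] [i' [j' [m' min' lt']]].
have /andP[? ?] := min_ij _ _ (merge_at_sym m').
have /andP[? ?] := min' _ _ (merge_at_sym m_ij).
have [ei ej] : i = j' /\ j = i' by lia.
by move: lt_ij lt'; rewrite ei ej; lia.
Qed.

Lemma merge_at_cat s t y : end_vertex s = end_vertex t ->
  merge_at (path_cat s y) (path_cat t y) (size s) (size t).
Proof.
by move=> e; split=> [|m]; rewrite ?path_vertex_cat // !path_catE.
Qed.

Lemma merge_at_catE x y i j : merge_at x y i j ->
  x = path_cat (mkseq x i) (path_drop i x) /\
  y = path_cat (mkseq y j) (path_drop i x).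
Proof.
case=> _ e; split; first by rewrite path_cat_mkseq.
rewrite -[LHS](path_cat_mkseq y j); congr path_cat.
by apply: funext => m; rewrite /path_drop e.
Qed.

Lemma tail_equivalent_cat s t y : end_vertex s = end_vertex t ->
  tail_equivalent (path_cat s y) (path_cat t y).
Proof. by move=> e; do 2 eexists; apply: merge_at_cat e. Qed.

Lemma tail_equivalent_trans y x z :
  tail_equivalent x y -> tail_equivalent y z -> tail_equivalent x z.
Proof.
move=> [i [j m_ij]] [j' [k m_jk]].
have {m_ij} := merge_atD (j' - j) m_ij; have {m_jk} := merge_atD (j - j') m_jk.
rewrite -!maxnE maxnC; set a := (k + _)%N; set b := (i + _)%N; set c := maxn _ _.
move=> [v1 e1] [v2 e2]; exists b, a; split; first by rewrite v2.
by move=> m; rewrite e2.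
Qed.

Lemma path_lt_last s t a b y : end_vertex (rcons s a) = end_vertex (rcons t b) ->
  (step_rank a < step_rank b)%N ->
  path_lt (path_cat (rcons s a) y) (path_cat (rcons t b) y).
Proof.
move=> e lt_ab; apply: (@path_lt_intro _ _ (size s) (size t)); last by rewrite !path_cat_size.
by rewrite -(size_rcons s a) -(size_rcons t b); apply: merge_at_cat.
Qed.

(** * Successors *)

(** The first and the last of the path segments from the root to [v]. *)
Definition first_word (v : vertex) : seq step := nseq v.1 Hor ++ nseq v.2 Ver.
Definition last_word (v : vertex) : seq step := nseq v.2 Ver ++ nseq v.1 Hor.

Lemma end_vertex_nseqH n : end_vertex (nseq n Hor) = (n, 0%N).
Proof. by elim: n => // n IHn; rewrite -addn1 nseqD end_vertex_cat IHn addn1. Qed.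

Lemma end_vertex_nseqV n : end_vertex (nseq n Ver) = (0%N, n).
Proof. by elim: n => // n IHn; rewrite -addn1 nseqD end_vertex_cat IHn addn1. Qed.

Lemma end_first_word v : end_vertex (first_word v) = v.
Proof.
by rewrite end_vertex_cat end_vertex_nseqH end_vertex_nseqV addn0; case: v.
Qed.

Lemma end_last_word v : end_vertex (last_word v) = v.
Proof. by rewrite end_vertex_catC end_first_word. Qed.

Lemma move_inj a : injective (move ^~ a).
Proof. by case: a => -[n k] [n' k'] /= [-> ->]. Qed.

Lemma nseqSr (T : Type) n (a : T) : nseq n.+1 a = rcons (nseq n a) a.
Proof. by rewrite -cats1 -addn1 nseqD. Qed.

Lemma first_word_Ver n k : first_word (n, k.+1) = rcons (first_word (n, k)) Ver.
Proof. by rewrite /first_word nseqSr -!cats1 catA. Qed.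

Lemma first_word_Hor n : first_word (n.+1, 0%N) = rcons (first_word (n, 0%N)) Hor.
Proof. by rewrite /first_word !cats0 nseqSr. Qed.

Lemma last_word_Hor n k : last_word (n.+1, k) = rcons (last_word (n, k)) Hor.
Proof. by rewrite /last_word nseqSr -!cats1 catA. Qed.

(** Among the paths through a vertex with a given continuation, the one that
    starts with [first_word] is the smallest. *)
Lemma first_word_min u : u = first_word (end_vertex u) \/
  forall y, path_lt (path_cat (first_word (end_vertex u)) y) (path_cat u y).
Proof.
elim/last_ind: u => [|u a]; first by left.
have dflt n k : end_vertex (rcons u a) = (n, k.+1) -> a != Ver -> forall y,
    path_lt (path_cat (first_word (n, k.+1)) y) (path_cat (rcons u a) y).
  move=> e aV y; rewrite first_word_Ver; apply: path_lt_last; last by clear e; case: a aV.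
  by rewrite -first_word_Ver end_first_word.
rewrite end_vertex_rcons; case: (end_vertex u) (end_vertex_rcons u a) => n k.
case: a dflt => /= dflt e IHu.
- case: k e IHu => [|k] e IHu; last by right; apply: dflt.
  rewrite first_word_Hor; case: IHu => [->|IHu]; first by left.
  by right=> y; rewrite !path_cat_rcons.
- by right; apply: dflt.
- rewrite first_word_Ver; case: IHu => [->|IHu]; first by left.
  by right=> y; rewrite !path_cat_rcons.
Qed.

(** No edge of [last_word v] can be replaced by a larger one that enters the
    same vertex. *)
Lemma last_word_max v y x i j : merge_at (path_cat (last_word v) y) x i.+1 j.+1 ->
  (i < size (last_word v))%N ->
  (step_rank (x j) <= step_rank (path_cat (last_word v) y i))%N.
Proof.
case: v => n k; rewrite /last_word /= => m_ij; rewrite size_cat !size_nseq => i_lt.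
have x_i : path_cat (last_word (n, k)) y i = if (i < k)%N then Ver else Hor.
  rewrite /path_cat /last_word /= size_cat !size_nseq i_lt nth_cat size_nseq.
  by rewrite !nth_nseq !if_same; case: (i < k)%N.
rewrite -/(last_word (n, k)) x_i; case: ifP => [i_k|_]; last by case: (x j).
case: m_ij => + _; rewrite [path_vertex x _]path_vertexS.
suff -> : path_vertex (path_cat (nseq k Ver ++ nseq n Hor) y) i.+1 = (0%N, i.+1).
  by case: (path_vertex x j) (x j) => a b [].
rewrite -(subnKC i_k) nseqD -catA path_cat_cat; set z := path_cat _ y.
by have := path_vertex_cat (nseq i.+1 Ver) z; rewrite size_nseq end_vertex_nseqV.
Qed.

(** The successor of a path whose first edge that is not last is [a]: the
    edge [a] is replaced by the next edge [b] into the same vertex, and what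
    comes before by the smallest path segment. *)
Lemma is_successor_cat v v' a b y : move v a = move v' b ->
  step_rank b = (step_rank a).+1 ->
  is_successor (path_cat (rcons (last_word v) a) y)
               (path_cat (rcons (first_word v') b) y).
Proof.
move=> e_v r_ab; set s := rcons _ a; set t := rcons _ b.
have e_st : end_vertex s = end_vertex t.
  by rewrite !end_vertex_rcons end_last_word end_first_word.
split; first by apply: path_lt_last => //; rewrite r_ab.
move=> z [i [j [m_ij _]]]; set x := path_cat s y in m_ij *.
have [le_i|lt_i] := leqP i (size (last_word v)); last first.
  (* [z] leaves [x] in the common part [y], hence it also leaves the candidate there. *)
  have [m i_eq] : exists m, i = (size s + m)%N.
    by exists (i - size s)%N; rewrite size_rcons; lia.
  have x_i : x i = path_cat t y (size t + m)%N by rewrite i_eq /x !path_catE.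
  rewrite x_i => lt_ij; right; apply: path_lt_intro lt_ij.
  have [v_st w_st] := merge_atD m.+1 (merge_at_cat y e_st).
  rewrite -addnS; case: m_ij => v_xz w_xz; split.
    by rewrite -v_st -v_xz i_eq addnS.
  by move=> l; rewrite -w_st -w_xz i_eq addnS.
rewrite leq_eqVlt in le_i; case/predU1P: le_i => [i_eq|lt_i]; last first.
  suff : (step_rank (z j) <= step_rank (x i))%N by lia.
  have x_eq : x = path_cat (last_word v) (path_cat [:: a] y).
    by rewrite /x path_cat_rcons.
  by rewrite x_eq in m_ij *; apply: last_word_max m_ij lt_i.
have x_i : x i = a by rewrite i_eq /x path_cat_size.
have {i_eq} i_eq : i.+1 = size s by rewrite size_rcons i_eq.
have z_eq : z = path_cat (rcons (mkseq z j) (z j)) y.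
  have [_ {1}->] := merge_at_catE m_ij; congr path_cat.
    exact: mkseqS.
  by rewrite i_eq /x path_catK.
have e_z : end_vertex (rcons (mkseq z j) (z j)) = end_vertex s.
  case: m_ij => + _; rewrite i_eq path_vertex_cat => ->.
  by rewrite path_vertexS end_vertex_rcons.
rewrite x_i => lt_a; have [z_j|z_j] := eqVneq (z j) b; last first.
  right; rewrite z_eq; apply: path_lt_last; first by rewrite e_z.
  by move: r_ab lt_a z_j; case: a {s x e_st x_i e_z e_v m_ij i_eq}; case: b {t}; case: (z j).
have e_u : end_vertex (mkseq z j) = v'.
  apply: (@move_inj b); rewrite -e_v -{1}z_j -end_vertex_rcons e_z.
  by rewrite end_vertex_rcons end_last_word.
have := first_word_min (mkseq z j); rewrite e_u => -[u_eq|lt_u].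
  by left; rewrite z_eq u_eq z_j.
by right; rewrite z_eq z_j /t !path_cat_rcons.
Qed.

Lemma adic_cat v v' a b y : move v a = move v' b ->
  step_rank b = (step_rank a).+1 ->
  adic (path_cat (rcons (last_word v) a) y) = path_cat (rcons (first_word v') b) y.
Proof.
move=> e_v r_ab; have [lt_xz min_z] := is_successor_cat y e_v r_ab.
rewrite /adic; case: asboolP => [x_max|_].
  have [_ /(_ b)] := x_max (size (last_word v)); rewrite path_cat_size.
  rewrite path_vertexS path_cat_size r_ab ltnn => h; suff: false by []; apply: h.
  exists v'; rewrite -e_v; congr move.
  by rewrite path_cat_rcons path_vertex_cat end_last_word.
apply: (@xget_unique _ _ [set y | is_successor _ y]) => [|z [lt_z min_z']].
  exact: is_successor_cat.
have [//|lt1] := min_z _ lt_z; have [//|lt2] := min_z' _ lt_xz.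
by have := path_lt_asym lt1 lt2.
Qed.

(** The constant horizontal and vertical paths belong to [path_max]. *)
Lemma adic_const a : a != Diag -> adic (fun=> a) = (fun=> a).
Proof.
move=> aD; rewrite /adic; case: asboolP => // -[] i.
have e_v : path_vertex (fun=> a) i = end_vertex (nseq i a).
  by congr end_vertex; elim: i => // i IHi; rewrite mkseqS IHi nseqSr.
split; rewrite path_vertexS e_v; first by eexists.
case: a aD {e_v} => // _; rewrite ?end_vertex_nseqH ?end_vertex_nseqV => s' [[n k]].
  by case: s'.
by case: s'.
Qed.

(** * Delannoy numbers *)

(** The number of paths from the root to [(n, k)], in closed form; the
    recurrence that counts paths is [delannoySS]. *)
Definition delannoy (n k : nat) : nat :=
  (\sum_(i < n.+1) 2 ^ i * 'C(n, i) * 'C(k, i))%N.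

Lemma delannoy_wide m n k : (n <= m)%N ->
  delannoy n k = (\sum_(i < m.+1) 2 ^ i * 'C(n, i) * 'C(k, i))%N.
Proof.
move=> n_m; pose F i := (2 ^ i * 'C(n, i) * 'C(k, i))%N.
rewrite /delannoy (big_ord_widen m.+1 F) ?ltnS // big_mkcond; apply: eq_bigr => i _.
by rewrite ltnS /F; case: leqP => // /bin_small ->; rewrite muln0.
Qed.

Lemma delannoy0n k : delannoy 0 k = 1%N.
Proof. by rewrite /delannoy big_ord1 !bin0. Qed.

Lemma delannoyn0 n : delannoy n 0 = 1%N.
Proof. by rewrite /delannoy big_ord_recl big1 ?bin0 // => i _; rewrite muln0. Qed.

Lemma delannoySS n k :
  delannoy n.+1 k.+1 = (delannoy n k.+1 + delannoy n k + delannoy n.+1 k)%N.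
Proof.
have w m l : (m <= n.+2)%N -> delannoy m l = _ := @delannoy_wide n.+2 m l.
rewrite (w n.+1 k.+1) // (w n k.+1) ?leqW // (w n k) ?leqW // (w n.+1 k) //.
rewrite !(big_ord_recl n.+2) !bin0 /= /bump /=.
set S1 := (\sum_(i < _) _)%N; set S2 := (\sum_(i < _) _)%N.
set S3 := (\sum_(i < _) _)%N; set S4 := (\sum_(i < _) _)%N.
pose c i := (2 ^ i * 'C(n, i) * 'C(k, i))%N.
have S13 : S1 = (S4 + \sum_(i < n.+2) (2 ^ i.+1 * 'C(n.+1, i.+1) * 'C(k, i)))%N.
  rewrite -big_split /=; apply: eq_bigr => i _.
  by rewrite (binS k) mulnDr.
have e2 : (\sum_(i < n.+2) c i = 1 + S3)%N.
  by rewrite -(delannoy_wide k (leqnSn n)) w ?leqW // big_ord_recl /= !bin0.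
have e1 : (\sum_(i < n.+2) 2 ^ i.+1 * 'C(n.+1, i.+1) * 'C(k, i) =
   \sum_(i < n.+2) 2 ^ i.+1 * 'C(n, i.+1) * 'C(k, i) + 2 * \sum_(i < n.+2) c i)%N.
  rewrite big_distrr /= -big_split /=; apply: eq_bigr => i _.
  by rewrite binS /c expnS; lia.
have e3 : (S2 = S3 + \sum_(i < n.+2) 2 ^ i.+1 * 'C(n, i.+1) * 'C(k, i))%N.
  rewrite -big_split /=; apply: eq_bigr => i _.
  by rewrite (binS k) mulnDr.
by lia.
Qed.

Lemma bin_pexp_eq0 p j i : prime p -> (0 < i < p ^ j)%N -> (p %| 'C(p ^ j, i))%N.
Proof.
move=> p_pr /andP[i_gt0 i_lt].
have C_gt0 : (0 < 'C(p ^ j, i))%N by rewrite bin_gt0 ltnW.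
have q_gt0 : (0 < p ^ j)%N by rewrite expn_gt0 prime_gt0.
have := mul_bin_diag (p ^ j) i.-1; rewrite prednK // => e.
have C'_gt0 : (0 < 'C((p ^ j).-1, i.-1))%N.
  by rewrite bin_gt0; move: i_gt0 i_lt; lia.
have := congr1 (logn p) e; rewrite !lognM // pfactorK // => e'.
have /(leq_trans)  i_lt' : (p ^ logn p i <= i)%N by rewrite dvdn_leq // pfactor_dvdnn.
have : (p ^ logn p i < p ^ j)%N by exact: leq_ltn_trans (i_lt' _ (leqnn _)) _.
rewrite ltn_exp2l ?prime_gt1 // => lt_j.
have : (0 < logn p 'C(p ^ j, i))%N by lia.
by rewrite logn_gt0 mem_primes => /and3P[].
Qed.

Section row.
Variables (p j : nat).
Hypothesis p_pr : prime p.
Let q := (p ^ j)%N.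
Let q_gt0 : (0 < q)%N. Proof. by rewrite expn_gt0 prime_gt0. Qed.
Let pchar_p : p \in [pchar 'F_p]. Proof. exact: pchar_Fp. Qed.

Lemma bin_pexp_Fp i : (0 < i < q)%N -> 'C(q, i)%:R = 0 :> 'F_p.
Proof. by move=> i_q; apply/eqP; rewrite -(dvdn_pcharf pchar_p) bin_pexp_eq0. Qed.

Lemma bin_predpexp_Fp i : (i < q)%N -> 'C(q.-1, i)%:R = (-1) ^+ i :> 'F_p.
Proof.
elim: i => [|i IHi] i_q; first by rewrite bin0.
have := @bin_pexp_Fp i.+1 i_q; rewrite -{1}(prednK q_gt0) binS natrD IHi 1?ltnW //.
by rewrite exprS mulN1r => /eqP; rewrite addr_eq0 => /eqP.
Qed.

Lemma bin_addpexp_Fp k i : (i < q)%N -> 'C(q + k, i)%:R = 'C(k, i)%:R :> 'F_p.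
Proof.
move=> i_q; rewrite -binomial.Vandermonde natr_sum big_ord_recl /= bin0 mul1n subn0.
rewrite big1 ?addr0 // => l _; rewrite natrM bin_pexp_Fp ?mul0r //=.
by rewrite (leq_ltn_trans _ i_q) // /bump /= add1n.
Qed.

(** Modulo [p], the Delannoy numbers of the column [p ^ j - 1] have period
    [p ^ j], because the binomials ['C(k, i)] with [i < p ^ j] have it, and for
    [k < p ^ j] they are [\sum_i (- 2) ^+ i * 'C(k, i) = (- 1) ^+ k]. *)
Lemma delannoy_predpexp k : ~~ (p %| delannoy q.-1 k)%N.
Proof.
rewrite (dvdn_pcharf pchar_p).
elim/ltn_ind: k => k IHk; have [k_q|q_k] := ltnP k q; last first.
  rewrite -(subnKC q_k); suff -> : (delannoy q.-1 (q + (k - q)))%:R =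
      (delannoy q.-1 (k - q))%:R :> 'F_p by apply: IHk; move: q_gt0; lia.
  rewrite /delannoy !natr_sum; apply: eq_bigr => i _.
  by rewrite !natrM bin_addpexp_Fp // (leq_trans (ltn_ord i)) // prednK.
suff -> : (delannoy q.-1 k)%:R = (- 2 + 1) ^+ k :> 'F_p.
  by rewrite expf_neq0 // [2](natrD _ 1 1) opprD addrNK oppr_eq0 oner_eq0.
rewrite exprD1n (big_ord_widen q (fun i => (- 2 : 'F_p) ^+ i *+ 'C(k, i))) //.
rewrite /delannoy natr_sum (prednK q_gt0) [RHS]big_mkcond; apply: eq_bigr => i _.
rewrite !natrM bin_predpexp_Fp // natrX -exprMn mulrN1 mulr_natr ltnS.
by case: leqP => // /bin_small ->; rewrite mulr0n.
Qed.
End row.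

(** * Eigenfunctions along a tail class *)

(** [Y] stands for a union of tail classes on which the eigenvalue equation
    holds everywhere. *)
Section eigenfunction.
Variables (K : fieldType) (f : delannoy_path -> K) (lambda : K).
Variable Y : set delannoy_path.
Hypothesis Y_sat : forall x y, tail_equivalent x y -> Y x -> Y y.
Hypothesis f_adic : forall x, Y x -> f (adic x) = lambda * f x.

Lemma eigen_last_Ver n k y : Y (path_cat (rcons (last_word (n.+1, k)) Ver) y) ->
  f (path_cat (rcons (first_word (n, k)) Diag) y) =
  lambda * f (path_cat (rcons (last_word (n.+1, k)) Ver) y).
Proof. by move=> Yx; rewrite -f_adic // (@adic_cat _ (n, k) _ Diag). Qed.

Lemma eigen_last_Diag n k y : Y (path_cat (rcons (last_word (n, k)) Diag) y) ->
  f (path_cat (rcons (first_word (n, k.+1)) Hor) y) =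
  lambda * f (path_cat (rcons (last_word (n, k)) Diag) y).
Proof. by move=> Yx; rewrite -f_adic // (@adic_cat _ (n, k.+1) _ Hor). Qed.

Lemma Y_cat s t y : end_vertex s = end_vertex t ->
  Y (path_cat s y) -> Y (path_cat t y).
Proof. by move=> e; apply: Y_sat; exact: tail_equivalent_cat. Qed.

(** The transformation applied [delannoy v.1 v.2 - 1] times leads from the
    first to the last path through [v] with a given continuation. *)
Lemma eigen_last_word v y : Y (path_cat (last_word v) y) ->
  lambda * f (path_cat (last_word v) y) =
  lambda ^+ delannoy v.1 v.2 * f (path_cat (first_word v) y).
Proof.
case: v => n k /=; elim: n k y => [|n IHn] k y.
  by rewrite delannoy0n /last_word /first_word cats0.
elim: k y => [|k IHk] y Yy.
  by rewrite delannoyn0 /last_word /first_word cats0.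
have Ys s a : end_vertex (rcons s a) = (n.+1, k.+1) ->
    Y (path_cat s (path_cat [:: a] y)).
  by move=> e; rewrite -path_cat_rcons; apply: Y_cat Yy; rewrite end_last_word.
have Yl v a : move v a = (n.+1, k.+1) -> Y (path_cat (last_word v) (path_cat [:: a] y)).
  by move=> e; apply: Ys; rewrite end_vertex_rcons end_last_word.
(* Backwards from the last path: first the paths that enter [(n.+1, k.+1)]
   from the left, then the diagonal ones, then those that come from below. *)
rewrite last_word_Hor path_cat_rcons IHn; last exact: Yl.
rewrite -path_cat_rcons eigen_last_Diag ?path_cat_rcons; last exact: Yl.
rewrite IHn; last exact: Yl.
rewrite -[path_cat (first_word _) _]path_cat_rcons eigen_last_Ver ?path_cat_rcons;
  last exact: Yl.
rewrite IHk; last exact: Yl.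
by rewrite first_word_Ver path_cat_rcons !mulrA -!exprD delannoySS.
Qed.

Lemma eigen_first_Diag v y : Y (path_cat (rcons (first_word v) Diag) y) ->
  f (path_cat (rcons (first_word v) Diag) y) =
  lambda ^+ delannoy v.1 v.2 * f (path_cat (first_word v) (path_cat [:: Hor; Ver] y)).
Proof.
case: v => n k Yy; have YV : Y (path_cat (rcons (last_word (n.+1, k)) Ver) y).
  by apply: Y_cat Yy; rewrite !end_vertex_rcons end_last_word end_first_word.
rewrite eigen_last_Ver // path_cat_rcons last_word_Hor path_cat_rcons.
rewrite -(path_cat_cat [:: Hor]) eigen_last_word //.
by rewrite path_cat_cat -!path_cat_rcons -last_word_Hor.
Qed.

Lemma eigen_first_Diag_Ver n k y : Y (path_cat (rcons (first_word (n, k)) Diag) y) ->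
  f (path_cat (rcons (first_word (n, k)) Diag) y) =
  lambda ^+ delannoy n.+1 k * f (path_cat (first_word (n.+1, k.+1)) y).
Proof.
move=> Yy; have YV : Y (path_cat (rcons (last_word (n.+1, k)) Ver) y).
  by apply: Y_cat Yy; rewrite !end_vertex_rcons end_last_word end_first_word.
rewrite eigen_last_Ver // path_cat_rcons eigen_last_word -?path_cat_rcons //.
by rewrite first_word_Ver.
Qed.

Lemma eigen_first_Hor n k y : Y (path_cat (rcons (first_word (n, k.+1)) Hor) y) ->
  f (path_cat (rcons (first_word (n, k.+1)) Hor) y) =
  lambda ^+ delannoy n k * f (path_cat (rcons (first_word (n, k)) Diag) y).
Proof.
move=> Yy; have YD : Y (path_cat (rcons (last_word (n, k)) Diag) y).
  by apply: Y_cat Yy; rewrite !end_vertex_rcons end_last_word end_first_word.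
by rewrite eigen_last_Diag // path_cat_rcons eigen_last_word -path_cat_rcons.
Qed.

Lemma eigen_first_word t : exists r, forall y, Y (path_cat t y) ->
  f (path_cat t y) = lambda ^+ r * f (path_cat (first_word (end_vertex t)) y).
Proof.
elim/last_ind: t => [|t a [r IHt]]; first by exists 0 => y _; rewrite expr0 mul1r.
suff [r' Hr'] : exists r', forall y, Y (path_cat (rcons t a) y) ->
    f (path_cat (rcons (first_word (end_vertex t)) a) y) =
    lambda ^+ r' * f (path_cat (first_word (end_vertex (rcons t a))) y).
  exists (r + r')%N => y Yy; rewrite exprD -mulrA -Hr' // !path_cat_rcons.
  by rewrite IHt // -path_cat_rcons.
rewrite end_vertex_rcons; move: (end_vertex t) (end_vertex_rcons t a) => [n k] e_t.
have Yf b v y : move v b = move (n, k) a -> Y (path_cat (rcons t a) y) ->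
    Y (path_cat (rcons (first_word v) b) y).
  by move=> e; apply: Y_cat; rewrite e_t end_vertex_rcons end_first_word.
case: a e_t Yf => /= e_t Yf.
- case: k e_t Yf => [|k] e_t Yf.
    by exists 0 => y _; rewrite expr0 mul1r first_word_Hor.
  exists (delannoy n k + delannoy n.+1 k)%N => y Yy.
  rewrite eigen_first_Hor; last exact: Yf.
  by rewrite eigen_first_Diag_Ver ?mulrA ?exprD; last exact: Yf.
- by exists (delannoy n.+1 k) => y Yy; apply: eigen_first_Diag_Ver; apply: Yf.
- by exists 0 => y _; rewrite expr0 mul1r first_word_Ver.
Qed.

(** Replacing a diagonal edge that leaves [v] by a horizontal and a vertical
    one moves a path back by [delannoy v.1 v.2] steps of the transformation. *)
Lemma eigen_Diag t y : Y (path_cat (rcons t Diag) y) ->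
  f (path_cat (rcons t Diag) y) =
  lambda ^+ delannoy (end_vertex t).1 (end_vertex t).2 *
    f (path_cat (t ++ [:: Hor; Ver]) y).
Proof.
move=> Yy; have [r fr] := eigen_first_word t; rewrite path_cat_rcons fr -?path_cat_rcons //.
rewrite eigen_first_Diag; last first.
  by apply: Y_cat Yy; rewrite !end_vertex_rcons end_first_word.
rewrite mulrCA path_cat_cat fr // -path_cat_cat.
apply: Y_cat Yy; rewrite -cats1 !end_vertex_cat; congr pair.
Qed.

(** The set where [f] does not vanish is a union of tail classes. *)
Lemma eigen_neq0 x y : lambda != 0 -> tail_equivalent x y -> Y x -> f x != 0 -> f y != 0.
Proof.
move=> l_neq0 [i [j m_ij]] Yx; have Yy : Y y by apply: Y_sat Yx; exists i, j.
have [x_eq y_eq] := merge_at_catE m_ij; case: m_ij; rewrite /path_vertex => e_ij _.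
have [r fr] := eigen_first_word (mkseq x i).
have [r' fr'] := eigen_first_word (mkseq y j).
rewrite x_eq y_eq fr -?x_eq // fr' -?y_eq // e_ij.
by rewrite !mulf_eq0 !expf_eq0 !(negbTE l_neq0) !andbF.
Qed.

End eigenfunction.

(** * The Borel sigma-algebra of the path space *)

Lemma cylinderP s x : cylinder s x <-> exists y, x = path_cat s y.
Proof.
split=> [sx|[y ->]]; last exact: cylinder_cat.
by exists (path_drop (size s) x); rewrite cylinder_catE.
Qed.

Lemma cylinder_mkseq x n : cylinder (mkseq x n) x.
Proof. by rewrite /cylinder /= size_mkseq. Qed.

Lemma cylinder_sub s x n : cylinder s x -> (size s <= n)%N ->
  cylinder (mkseq x n) `<=` cylinder s.
Proof.
move=> sx s_n y; rewrite /cylinder /= size_mkseq => xy.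
rewrite -[RHS]sx; apply: (@eq_from_nth _ Hor); rewrite ?size_mkseq // => i i_s.
have i_n := leq_trans i_s s_n.
by rewrite !nth_mkseq //; have := congr1 (nth Hor ^~ i) xy; rewrite !nth_mkseq.
Qed.

Lemma open_cylinder (U : set delannoy_path) x : open U -> U x ->
  exists2 n, cylinder (mkseq x n) x & cylinder (mkseq x n) `<=` U.
Proof.
move=> [D' D'sub <-] [A D'A Ax].
have [F0 _] := D'sub _ D'A; pose F : {fset seq step} := F0.
rewrite -/F => F_A.
exists (\max_(s <- enum_fset F) size s)%N; first exact: cylinder_mkseq.
have FA z : (A : set delannoy_path) z <-> forall s, s \in F -> cylinder s z.
  by rewrite -F_A; split=> h s; exact: h.
move=> y xy; exists A => //; apply/FA => s sF.
have sx : cylinder s x by move/FA: Ax; exact.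
apply: cylinder_sub sx _ _ xy.
exact: (@leq_bigmax_seq _ (enum_fset F) xpredT size).
Qed.

Lemma cylinder_open s : open (cylinder s).
Proof.
exists [set cylinder s]; last first.
  by apply/seteqP; split=> x; [move=> [_ ->]; exact: id|move=> sx; exists (cylinder s)].
move=> _ ->; exists [fset s]%fset; first by move=> ? _; exact: in_setT.
by apply/seteqP; split => [x|x sx i /=]; [apply; rewrite /= inE|rewrite inE => /eqP ->].
Qed.

Lemma measurable_cylinder s : measurable (cylinder s : set delannoy_space).
Proof. by apply: sub_sigma_algebra; exact: cylinder_open. Qed.

Lemma bigcup_measurable_countType d (T : sigmaRingType d) (I : countType)
    (P : set I) (F : I -> set T) :
  (forall i, P i -> measurable (F i)) -> measurable (\bigcup_(i in P) F i).
Proof.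
move=> mF; rewrite bigcup_mkcond; apply: countable_bigcupT_measurable => [|i].
  exact: countableP.
by case: ifPn => // /set_mem/mF.
Qed.

(** A countable generator of the Borel sets that is closed under intersection. *)
Definition cylinder_or_empty : set (set delannoy_space) :=
  [set A | A = set0 \/ exists s, A = cylinder s].

Lemma cylinder_setI_closed : setI_closed cylinder_or_empty.
Proof.
have cyl_cap s t : (size s <= size t)%N -> cylinder_or_empty (cylinder s `&` cylinder t).
  move=> s_t; have [[x [sx tx]]|] := pselect (cylinder s `&` cylinder t !=set0).
    right; exists t; apply/setIidPr.
    by have := cylinder_sub sx s_t; rewrite [mkseq _ _]tx.
  by move=> /set0P/negP/negPn/eqP ->; left.
move=> A B [->|[s ->]] [->|[t ->]]; rewrite ?set0I ?setI0; try by left.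
by have [|/ltnW] := leqP (size s) (size t); [|rewrite setIC]; apply: cyl_cap.
Qed.

Lemma measurable_delannoyE :
  @measurable _ delannoy_space = <<s cylinder_or_empty >>.
Proof.
apply/seteqP; split; last first.
  apply: smallest_sub; first exact: sigma_algebra_measurable.
  by move=> A [->|[s ->]]; [exact: measurable0|exact: measurable_cylinder].
apply: smallest_sub; first exact: smallest_sigma_algebra.
move=> U U_open.
have -> : U = \bigcup_(s in [set s | cylinder s `<=` U]) cylinder s.
  apply/seteqP; split=> [x Ux|x [s sU sx]]; last exact: sU.
  by have [n nx nU] := open_cylinder U_open Ux; exists (mkseq x n).
apply: (@bigcup_measurable_countType _ (g_sigma_algebraType cylinder_or_empty)) => s _.
by apply: sub_sigma_algebra; right; exists s.
Qed.

(** A map is measurable if it pulls cylinders back to measurable sets. *)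
Lemma measurable_path_map d (T : measurableType d) (g : T -> delannoy_space) :
  (forall s, measurable (g @^-1` cylinder s)) -> measurable_fun setT g.
Proof.
move=> mg; apply: (measurability cylinder_or_empty measurable_delannoyE).
move=> _ [_ [->|[s ->]] <-]; rewrite setTI; first by rewrite preimage_set0.
exact: mg.
Qed.

(** Sets that only depend on the first [n] edges. *)
Definition determined (n : nat) (C : set delannoy_path) :=
  forall x y, mkseq x n = mkseq y n -> C x -> C y.

Lemma mkseq_le (x y : delannoy_path) m n : (m <= n)%N ->
  mkseq x n = mkseq y n -> mkseq x m = mkseq y m.
Proof.
by move=> m_n; rewrite -(subnKC m_n) !mkseq_cat => /eqP;
  rewrite eqseq_cat ?size_mkseq // => /andP[/eqP].
Qed.

Lemma determined_le m n C : (m <= n)%N -> determined m C -> determined n C.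
Proof. by move=> m_n dC x y /(mkseq_le m_n); exact: dC. Qed.

Lemma measurable_determined n C : determined n C -> measurable (C : set delannoy_space).
Proof.
move=> dC; suff -> : C = \bigcup_(s in [set s | cylinder s `<=` C]) cylinder s.
  by apply: bigcup_measurable_countType => s _; exact: measurable_cylinder.
apply/seteqP; split=> [x Cx|x [s sC sx]]; last exact: sC.
exists (mkseq x n); last exact: cylinder_mkseq.
by move=> y; rewrite /cylinder /= size_mkseq => xy; apply: dC Cx.
Qed.

Lemma measurable_step i a : measurable ([set x | x i = a] : set delannoy_space).
Proof.
apply: (@measurable_determined i.+1) => x y; rewrite !mkseqS => /rcons_inj[_ e] /=.
by rewrite e.
Qed.

Lemma measurable_path_cat s :
  measurable_fun setT (path_cat s : delannoy_space -> delannoy_space).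
Proof.
apply: measurable_path_map => t; apply: (@measurable_determined (size t)) => y z yz.
rewrite /preimage /= /cylinder /= => <-.
apply: (@eq_from_nth _ Hor); rewrite ?size_mkseq // => i i_t.
rewrite !nth_mkseq // /path_cat; case: ifP => // _.
have := congr1 (nth Hor ^~ (i - size s)%N) yz.
rewrite !nth_mkseq //; exact: leq_ltn_trans (leq_subr _ _) i_t.
Qed.

Lemma measurable_path_drop n :
  measurable_fun setT (path_drop n : delannoy_space -> delannoy_space).
Proof.
apply: measurable_path_map => t; apply: (@measurable_determined (n + size t)) => y z yz.
rewrite /preimage /= /cylinder /= => <-; move: yz; rewrite !mkseq_cat => /eqP.
by rewrite eqseq_cat ?size_mkseq // => /andP[_ /eqP].
Qed.

(** * Measures invariant under the tail relation *)

Lemma image_path_cat u (E : set delannoy_path) :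
  path_cat u @` E = cylinder u `&` path_drop (size u) @^-1` E.
Proof.
apply/seteqP; split=> [_ [y Ey <-]|x [ux Ex]].
  by split; [exact: cylinder_cat|rewrite /preimage /= path_catK].
by exists (path_drop (size u) x) => //; rewrite cylinder_catE.
Qed.

Lemma measurable_image_path_cat u (E : set delannoy_space) :
  measurable E -> measurable (path_cat u @` E : set delannoy_space).
Proof.
move=> mE; rewrite image_path_cat; apply: measurableI; first exact: measurable_cylinder.
by rewrite -[X in measurable X]setTI; apply: measurable_path_drop.
Qed.

Lemma measurable_preimage_path_cat u (E : set delannoy_space) :
  measurable E -> measurable (path_cat u @^-1` E : set delannoy_space).
Proof. by move=> mE; rewrite -[X in measurable X]setTI; apply: measurable_path_cat. Qed.

Lemma image_path_cat_cylinder u t : path_cat u @` (cylinder t) = cylinder (u ++ t).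
Proof.
apply/seteqP; split=> [_ [_ /cylinderP[y ->] <-]|x /cylinderP[y ->]].
  by rewrite -path_cat_cat; exact: cylinder_cat.
by exists (path_cat t y); [exact: cylinder_cat|rewrite path_cat_cat].
Qed.

Section invariant_measure.
Context {R : realType} (mu : probability delannoy_space R).
Hypothesis mu_inv : tail_invariant mu.
Local Open Scope ereal_scope.

Lemma probability_lty (A : set delannoy_space) : measurable A -> mu A < +oo.
Proof. by move=> mA; rewrite (le_lt_trans (probability_le1 mu mA)) ?ltry. Qed.

Lemma mu_le (A B : set delannoy_space) : measurable A -> measurable B -> A `<=` B ->
  mu A <= mu B.
Proof. by move=> mA mB; apply: le_measure; rewrite inE. Qed.

(** Tail invariance on cylinders extends to Borel sets of continuations. *)
Lemma mu_path_cat u w (E : set delannoy_space) : end_vertex u = end_vertex w ->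
  measurable E -> mu (path_cat u @` E) = mu (path_cat w @` E).
Proof.
move=> uw mE; move: (mE); rewrite measurable_delannoyE; move: E {mE}.
apply: (dynkin_induction measurable_delannoyE cylinder_setI_closed).
- by rewrite /= !image_path_cat !preimage_setT !setIT; exact: mu_inv.
- move=> _ [->|[t ->]] /=; first by rewrite !image_set0.
  by rewrite !image_path_cat_cylinder; apply: mu_inv; rewrite !end_vertex_cat uw.
- move=> E mE /= IH.
  have C v : mu (path_cat v @` (~` E)) = mu (cylinder v) - mu (path_cat v @` E).
    have -> : path_cat v @` (~` E) = cylinder v `\` path_cat v @` E.
      by rewrite !image_path_cat; apply/seteqP; split=> x /= [vx Ex]; tauto.
    rewrite measureD.
    - by congr (_ - mu _); rewrite image_path_cat setIA setIid.
    - exact: measurable_cylinder.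
    - exact: measurable_image_path_cat.
    - by apply: probability_lty; exact: measurable_cylinder.
  by rewrite !C IH (mu_inv uw).
- move=> F mF tF IH /=.
  have C v : mu (path_cat v @` (\bigcup_k F k)) = \sum_(0 <= k <oo) mu (path_cat v @` F k).
    rewrite image_bigcup measure_semi_bigcup //.
    - by move=> i; exact: measurable_image_path_cat.
    - apply/trivIsetP => i j _ _ ij; rewrite -subset0 => _ [[y Fy <-] [z Fz /path_cat_inj zy]].
      have : (F i `&` F j) y by split=> //; rewrite -zy.
      by move/trivIsetP: tF => /(_ i j Logic.I Logic.I ij) ->.
    - by apply: bigcupT_measurable => i; exact: measurable_image_path_cat.
  by rewrite !C; apply: eq_eseriesr => k _; exact: IH.
Qed.

(** An injection of [G] into [F] that replaces initial segments by segments
    with the same endpoint does not decrease the measure.  The countably many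
    replacements [u i -> w i] need only be disjoint on the side of [F]. *)
Lemma swap_le (I : countType) (P : set I) (u w : I -> seq step)
    (G F : set delannoy_space) :
  measurable G -> measurable F ->
  (forall i, P i -> end_vertex (u i) = end_vertex (w i)) ->
  (forall x, G x -> exists2 i, P i & cylinder (u i) x) ->
  (forall i y, P i -> G (path_cat (u i) y) -> F (path_cat (w i) y)) ->
  (forall i j y z, P i -> P j -> G (path_cat (u i) y) -> G (path_cat (u j) z) ->
    path_cat (w i) y = path_cat (w j) z -> i = j) ->
  mu G <= mu F.
Proof.
move=> mG mF uw G_cover wF w_inj.
pose E i : set delannoy_space := if `[< P i >] then path_cat (u i) @^-1` G else set0.
have mE i : measurable (E i).
  by rewrite /E; case: ifP => _ //; exact: measurable_preimage_path_cat.
have EP i y : E i y -> P i /\ G (path_cat (u i) y).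
  by rewrite /E; case: asboolP.
pose A (k : nat) : set delannoy_space :=
  if pickle_inv k is Some i then path_cat (u i) @` E i else set0.
pose B (k : nat) : set delannoy_space :=
  if pickle_inv k is Some i then path_cat (w i) @` E i else set0.
have mA k : measurable (A k).
  by rewrite /A; case: pickle_inv => // i; exact: measurable_image_path_cat.
have mB k : measurable (B k).
  by rewrite /B; case: pickle_inv => // i; exact: measurable_image_path_cat.
have AB k : mu (A k) = mu (B k).
  rewrite /A /B; case: pickle_inv => // i; rewrite /E; case: asboolP => [Pi|_].
    by apply: mu_path_cat; [exact: uw|exact: measurable_preimage_path_cat].
  by rewrite !image_set0.
have GA : G `<=` \bigcup_k A k.
  move=> x Gx; have [i Pi ux] := G_cover x Gx.
  exists (choice.pickle i) => //; rewrite /A pickleK_inv.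
  exists (path_drop (size (u i)) x); last exact: cylinder_catE.
  by rewrite /E; case: asboolP => // _; rewrite /preimage /= cylinder_catE.
apply: (le_trans (measure_sigma_subadditive mu mA mG GA)).
rewrite (eq_eseriesr (fun k _ => AB k)) -measure_semi_bigcup //.
- apply: mu_le => //; first exact: bigcupT_measurable.
  move=> x [k _]; rewrite /B; case: pickle_inv => // i [y /EP[Pi Gy] <-].
  exact: wF.
- apply/trivIsetP => k l _ _; apply: contra_neqP => /eqP/set0P[x []].
  rewrite /B; case ek: (pickle_inv k) => [i|//]; case el: (pickle_inv l) => [j|//].
  move=> [y /EP[Pi Gy] <-] [z /EP[Pj Gz] yz].
  have ij := w_inj _ _ _ _ Pi Pj Gy Gz (esym yz).
  have := @pickle_invK I k; have := @pickle_invK I l; rewrite ek el /= => <- <-.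
  by rewrite ij.
- exact: bigcupT_measurable.
Qed.

Lemma mu_subU (E A B : set delannoy_space) a b :
  measurable E -> measurable A -> measurable B -> E `<=` A `|` B ->
  mu A <= a -> mu B <= b -> mu E <= a + b.
Proof.
move=> mE mA mB EAB Aa Bb; apply: le_trans (leeD Aa Bb).
apply: le_trans (measureU2 _ mA mB); apply: mu_le => //; exact: measurableU.
Qed.

(** Continuity from above, in the form: if a decreasing sequence with empty
    intersection has measures eventually at least [c], then [c <= 0]. *)
Lemma mu_decreasing_empty (F : nat -> set delannoy_space) m c :
  (forall n, measurable (F n)) ->
  (forall n p, (n <= p)%N -> F p `<=` F n) -> \bigcap_n F n = set0 ->
  (forall n, (m <= n)%N -> c <= mu (F n)) -> c <= 0.
Proof.
move=> mF decF F0 cF.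
have cv : mu \o F @ \oo --> mu (\bigcap_n F n).
  apply: nonincreasing_cvg_mu => //.
  - exact: probability_lty.
  - by rewrite F0.
  - by move=> n p np; apply/subsetPset; exact: decF.
rewrite F0 measure0 in cv.
rewrite -(cvg_lim _ cv) //; apply: lime_ge; first by apply/cvg_ex; exists 0.
by exists m => // n /= mn; exact: cF.
Qed.

(** Sets that depend on finitely many edges are dense in measure. *)
Lemma approx_determined (E : set delannoy_space) (e : R) : measurable E -> (0 < e)%R ->
  exists n, exists2 C : set delannoy_space, determined n C &
      mu (E `\` C) <= e%:E /\ mu (C `\` E) <= e%:E.
Proof.
move=> mE; move: e; suff : [set E : set delannoy_space | measurable E /\ forall e : R, (0 < e)%R ->
    exists n, exists2 C : set delannoy_space, determined n C &
      mu (E `\` C) <= e%:E /\ mu (C `\` E) <= e%:E] E.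
  by case.
have mD n (C A : set delannoy_space) : determined n C -> measurable A ->
    measurable (A `\` C) /\ measurable (C `\` A).
  by move=> /measurable_determined mC mA; split; exact: measurableD.
have sE : <<s cylinder_or_empty >> E by rewrite -measurable_delannoyE.
apply: (@lambda_system_subset _ cylinder_or_empty cylinder_setI_closed setT) sE => //.
- split=> //.
  + split=> // e e0; exists 0%N, setT; first by [].
    by rewrite setDv measure0 lee_fin ltW.
  + move=> A B BA [mA HA] [mB HB]; split; first exact: measurableD.
    move=> e e0; have e20 : (0 < e / 2)%R by rewrite divr_gt0.
    have [n [C dC [AC CA]]] := HA _ e20; have [p [D dD [BD DB]]] := HB _ e20.
    have dCD : determined (maxn n p) (C `\` D).
      move=> x y xy [Cx Dx]; split; first exact: determined_le (leq_maxl _ _) dC _ _ xy Cx.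
      by move=> Dy; apply: Dx; exact: determined_le (leq_maxr _ _) dD _ _ (esym xy) Dy.
    have [mAC mCA] := mD _ _ _ dC mA; have [mBD mDB] := mD _ _ _ dD mB.
    have [mABCD mCDAB] := mD _ _ _ dCD (measurableD mA mB).
    exists (maxn n p), (C `\` D) => //; rewrite (splitr e) EFinD; split.
      apply: (mu_subU mABCD mAC mDB) => // x [[Ax nB] nCD].
      by have [Dx|nD] := pselect (D x); [right|left; split=> // Cx; exact: nCD].
    apply: (mu_subU mCDAB mCA mBD) => // x [[Cx nD] nAB].
    by have [Bx|nB] := pselect (B x); [right|left; split=> // Ax; exact: nAB].
  + move=> F ndF HF; have mF n : measurable (F n) by have [] := HF n.
    have mU : measurable (\bigcup_n F n) by exact: bigcupT_measurable.
    split=> // e e0; have e20 : (0 < e / 2)%R by rewrite divr_gt0.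
    have [[N FN]|noN] := pselect (exists N, mu (\bigcup_n F n `\` F N) <= (e / 2)%:E); last first.
      have : (e / 2)%:E <= 0.
        apply: (@mu_decreasing_empty (fun N => \bigcup_n F n `\` F N : set delannoy_space) 0%N).
        - by move=> n; exact: measurableD.
        - by move=> n p np x [Ux nF]; split=> // /(subsetPset _ _ (ndF _ _ np)).
        - by rewrite -subset0 => x h; have [[n _ Fx] _] := h 0%N I; have [_] := h n I; apply.
        - move=> n _; apply: ltW; rewrite ltNge; apply/negP => le; apply: noN; by exists n.
      by rewrite lee_fin leNgt e20.
    have [_ /(_ _ e20)[n [C dC [FC CF]]]] := HF N.
    have [mFC mCF] := mD _ _ _ dC (mF N); have [mUC mCU] := mD _ _ _ dC mU.
    have mUF : measurable (\bigcup_n F n `\` F N) by exact: measurableD.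
    exists n, C => //; rewrite (splitr e) EFinD; split.
      apply: (mu_subU mUC mUF mFC) => // x [Ux nC].
      by have [Fx|nF] := pselect (F N x); [right|left].
    rewrite -[X in X <= _]adde0; apply: leeD; last by rewrite lee_fin ltW.
    apply: le_trans CF; apply: mu_le => // x [Cx nU]; split=> // Fx; apply: nU.
    by exists N.
- move=> _ [->|[s ->]].
    by split=> // e e0; exists 0%N, set0; rewrite ?setDv ?measure0 ?lee_fin ?ltW.
  split=> [|e e0]; first exact: measurable_cylinder.
  exists (size s), (cylinder s); last by rewrite setDv measure0 lee_fin ltW.
  by move=> x y; rewrite /cylinder /= => ->.
Qed.

(** * Paths with finitely many non-vertical edges *)

(** The last non-vertical edge is the one at time [m]. *)
Definition last_nonVer (m : nat) : set delannoy_path :=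
  [set x | x m != Ver /\ forall k, (m < k)%N -> x k = Ver].

(** Paths with infinitely many non-vertical edges: they hit every column. *)
Definition inf_nonVer : set delannoy_path :=
  [set x | forall m, exists2 k, (m <= k)%N & x k != Ver].

Lemma measurable_last_nonVer m : measurable (last_nonVer m : set delannoy_space).
Proof.
have -> : last_nonVer m = ~` [set x | x m = Ver] `&`
    \bigcap_(k in [set k | (m < k)%N]) [set x | x k = Ver].
  by apply/seteqP; split=> x [/= xm xV]; split=> //; exact/eqP.
apply: measurableI; first by apply: measurableC; exact: measurable_step.
by apply: bigcap_measurableType => k _; exact: measurable_step.
Qed.

Lemma mu_last_nonVerS m : mu (last_nonVer m) <= mu (last_nonVer m.+1).
Proof.
apply: (@swap_le (seq step * step)%type [set sa | size sa.1 = m /\ sa.2 != Ver]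
  (fun sa => sa.1 ++ [:: sa.2; Ver]) (fun sa => sa.1 ++ [:: Ver; sa.2])).
- exact: measurable_last_nonVer.
- exact: measurable_last_nonVer.
- by move=> [s a] _; rewrite !end_vertex_cat (end_vertex_catC [:: a] [:: Ver]).
- move=> x [xm xV]; exists (mkseq x m, x m); first by rewrite /= size_mkseq.
  rewrite /= -cat_rcons -mkseqS -[Ver](xV m.+1) // cats1 -mkseqS; exact: cylinder_mkseq.
- move=> [s a] y [/= sm aV] [_ yV]; split.
    rewrite -[m.+1]/(1 + m)%N addnC -sm path_cat_cat path_catE; exact: aV.
  move=> k mk; have := yV k (ltnW mk); rewrite !path_cat_cat /path_cat /= sm.
  have -> : (k < m)%N = false by lia.
  by have -> : (k - m < 2)%N = false by lia.
- move=> [s a] [t b] y z [/= sm _] [/= tm _] _ _ e.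
  have e2 := congr1 (fun x => mkseq x m.+2) e.
  have sz r c : size r = m -> size (r ++ [:: Ver; c]) = m.+2.
    by move=> rm; rewrite size_cat rm addn2.
  rewrite /= -{1}(sz s a sm) -(sz t b tm) !mkseq_path_cat in e2.
  by move/eqP: e2; rewrite eqseq_cat ?sm ?tm // => /andP[/eqP -> /eqP[->]].
Qed.

(** By exchangeability the measures of these disjoint sets are nondecreasing
    in [m], hence they vanish. *)
Lemma mu_last_nonVer m : mu (last_nonVer m) = 0.
Proof.
apply/eqP; rewrite eq_le measure_ge0 andbT.
apply: (@mu_decreasing_empty (fun n => \bigcup_(k in [set k | (n <= k)%N]) last_nonVer k) m).
- by move=> n; apply: bigcup_measurable => k _; exact: measurable_last_nonVer.
- by move=> n p np x [k /= pk xk]; exists k => //=; exact: leq_trans np pk.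
- rewrite -subset0 => x h; have [k _ [_ xV]] := h 0%N I.
  by have [l /= kl [/eqP]] := h k.+1 I; rewrite xV.
- move=> n mn; apply: (@le_trans _ _ (mu (last_nonVer n))).
    elim: n mn => [|n IHn]; first by rewrite leqn0 => /eqP ->.
    rewrite leq_eqVlt => /predU1P[-> //|]; rewrite ltnS => /IHn le_n.
    exact: le_trans le_n (mu_last_nonVerS n).
  apply: mu_le; first exact: measurable_last_nonVer.
    by apply: bigcup_measurable => k _; exact: measurable_last_nonVer.
  by move=> x xn; exists n => /=.
Qed.
End invariant_measure.

(** * Hitting a column *)

(** [t] ends in column [n], and none of its proper prefixes does. *)
Definition first_hit (n : nat) (t : seq step) : Prop :=
  (end_vertex t).1 = n /\
  forall k, (k < size t)%N -> ((end_vertex (take k t)).1 < n)%N.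

(** Paths that continue by a diagonal edge when they first hit column [n]. *)
Definition Diag_at_hit (n : nat) : set delannoy_path :=
  [set x | exists2 t, first_hit n t & cylinder (rcons t Diag) x].

Lemma take_mkseq (x : delannoy_path) k l : (k <= l)%N -> take k (mkseq x l) = mkseq x k.
Proof.
by move=> kl; rewrite -(subnKC kl) mkseq_cat take_size_cat ?size_mkseq.
Qed.

Lemma end_vertex_size t : ((end_vertex t).1 <= size t)%N.
Proof.
elim/last_ind: t => // t a; rewrite end_vertex_rcons size_rcons.
by case: a => /=; lia.
Qed.

Lemma first_hit_size n t : first_hit n t -> (n <= size t)%N.
Proof. by move=> [<- _]; exact: end_vertex_size. Qed.

Lemma first_hit_exists n x : inf_nonVer x -> exists l, first_hit n (mkseq x l).
Proof.
move=> x_inf; have ex l : exists l', (l <= (path_vertex x l').1)%N.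
  elim: l => [|l [l' IHl]]; first by exists 0%N.
  have [k lk xk] := x_inf l'; exists k.+1.
  have le_k : ((path_vertex x l').1 <= (path_vertex x k).1)%N.
    rewrite -(subnKC lk); elim: (k - l')%N => [|m IHm]; first by rewrite addn0.
    by rewrite addnS path_vertexS (leq_trans IHm) //; case: (x _) => /=.
  by rewrite path_vertexS; case: (x k) xk => //= _; lia.
case: (ex_minnP (ex n)) => l nl l_min; exists l.
have lt_n k : (k < l)%N -> ((path_vertex x k).1 < n)%N.
  by move=> kl; rewrite ltnNge; apply/negP => /l_min; lia.
split=> [|k]; last by rewrite size_mkseq => kl; rewrite (take_mkseq _ (ltnW kl)); exact: lt_n.
apply/eqP; rewrite eqn_leq nl andbT; case: l {l_min} nl lt_n => [//|l] nl lt_n.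
have := lt_n l (ltnSn l); rewrite -/(path_vertex x l.+1) path_vertexS.
by case: (x l) => /=; lia.
Qed.

(** A path first hits a column at most once. *)
Lemma first_hit_unique n s t y z : first_hit n s -> first_hit n t ->
  path_cat s y = path_cat t z -> s = t.
Proof.
move=> hs ht e; have le u v y' z' : first_hit n u -> first_hit n v ->
    path_cat u y' = path_cat v z' -> (size v <= size u)%N.
  move=> [hu _] [_ hv] e'; rewrite leqNgt; apply/negP => uv.
  have := hv _ uv; suff -> : take (size u) v = u by rewrite hu ltnn.
  by rewrite -[in LHS](mkseq_path_cat v z') -e' take_mkseq ?mkseq_path_cat // ltnW.
have st : size s = size t.
  by apply/eqP; rewrite eqn_leq (le _ _ _ _ ht hs (esym e)) (le _ _ _ _ hs ht e).
by rewrite -(mkseq_path_cat s y) e st mkseq_path_cat.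
Qed.

Lemma measurable_Diag_at_hit n : measurable (Diag_at_hit n : set delannoy_space).
Proof.
rewrite (_ : Diag_at_hit n = \bigcup_(t in first_hit n) cylinder (rcons t Diag)) //.
by apply: bigcup_measurable_countType => t _; exact: measurable_cylinder.
Qed.

Lemma measurable_inf_nonVer : measurable (inf_nonVer : set delannoy_space).
Proof.
have -> : inf_nonVer = \bigcap_m \bigcup_(k in [set k | (m <= k)%N]) ~` [set x | x k = Ver].
  apply/seteqP; split=> x xV m; first by have [k mk /eqP xk] := xV m; exists k.
  by have [k mk /eqP xk] := xV m I; exists k.
apply: bigcapT_measurable => m; apply: bigcup_measurable => k _.
by apply: measurableC; exact: measurable_step.
Qed.

Lemma measurable_const_path a : measurable ([set (fun=> a)] : set delannoy_space).
Proof.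
rewrite (_ : [set _] = \bigcap_i [set x | x i = a]).
  by apply: bigcapT_measurable => i; exact: measurable_step.
apply/seteqP; split=> [x -> //|x h]; apply: funext => i; exact: h.
Qed.

Section hit_estimates.
Context {R : realType} (mu : probability delannoy_space R).
Hypothesis mu_inv : tail_invariant mu.
Local Open Scope ereal_scope.

Lemma mu_step0_le i a : mu [set x | x 0%N = a] <= mu [set x | x i = a].
Proof.
apply: (@swap_le _ mu mu_inv (seq step) [set s | size s = i] (cons a) (rcons ^~ a)).
- exact: measurable_step.
- exact: measurable_step.
- by move=> s _; rewrite -cats1 -cat1s end_vertex_catC.
- move=> x /= x0; exists (mkseq (path_drop 1 x) i); first by rewrite /= size_mkseq.
  have -> : a :: mkseq (path_drop 1 x) i = mkseq x (1 + i) by rewrite mkseq_cat -x0.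
  exact: cylinder_mkseq.
- by move=> s y /= <- _; rewrite path_cat_size.
- move=> s t y z /= si ti _ _ e.
  have := congr1 (fun x => mkseq x i.+1) e; rewrite /=.
  rewrite -{1}si -ti -(size_rcons s a) -(size_rcons t a) !mkseq_path_cat.
  by move/rcons_inj => [].
Qed.

Lemma mu_bigcup0 (I : countType) (P : set I) (F : I -> set delannoy_space) :
  (forall i, P i -> measurable (F i)) -> (forall i, P i -> mu (F i) = 0) ->
  mu (\bigcup_(i in P) F i) = 0.
Proof.
move=> mF F0; apply: measure_negligible; first exact: bigcup_measurable_countType.
pose A (k : nat) : set delannoy_space :=
  if pickle_inv k is Some i then (if `[< P i >] then F i else set0) else set0.
apply: (@negligibleS _ _ _ _ (\bigcup_k A k)).
  move=> x [i Pi Fx]; exists (choice.pickle i) => //.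
  by rewrite /A pickleK_inv; case: asboolP.
apply: negligible_bigcup => k; rewrite /A; case: pickle_inv => [i|]; last exact: negligible_set0.
case: asboolP => Pi; last exact: negligible_set0.
by apply/negligibleP; [exact: mF|exact: F0].
Qed.

Lemma mu_inf_nonVerC : mu [set (fun=> Ver)] = 0 -> mu (~` inf_nonVer) = 0.
Proof.
move=> V0; apply/eqP; rewrite eq_le measure_ge0 andbT -[leRHS]adde0.
have mL : measurable (\bigcup_m last_nonVer m : set delannoy_space).
  by apply: bigcupT_measurable => m; exact: measurable_last_nonVer.
apply: (@mu_subU _ mu _ [set (fun=> Ver)] (\bigcup_m last_nonVer m)) => //.
- by apply: measurableC; exact: measurable_inf_nonVer.
- exact: measurable_const_path.
- move=> x /= x_fin; have ex : exists m, `[< forall k, (m <= k)%N -> x k = Ver >].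
    have [//|no] := pselect (exists m, `[< forall k, (m <= k)%N -> x k = Ver >]).
    exfalso; apply: x_fin => m; have [//|no'] := pselect (exists2 k, (m <= k)%N & x k != Ver).
    exfalso; apply: no; exists m; apply/asboolP => k mk; apply/eqP/negPn/negP => xk.
    by apply: no'; exists k.
  case: (ex_minnP ex) => -[|m] /asboolP xV m_min.
    by left; apply: funext => k; exact: xV.
  right; exists m => //; split=> //; apply/negP => /eqP xm.
  have := m_min m; rewrite ltnn => h; suff: false by []; apply: h.
  by apply/asboolP => k; rewrite leq_eqVlt => /predU1P[<- //|]; exact: xV.
- by rewrite V0.
- by rewrite mu_bigcup0 // => m _; [exact: measurable_last_nonVer|exact: mu_last_nonVer].
Qed.

(** Exchangeability: a diagonal edge at time [i] can be postponed until the
    path without this edge first hits column [n]. *)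
Lemma mu_Diag_le_hit n i C : (i < n)%N -> determined i C ->
  mu (~` inf_nonVer) = 0 ->
  mu (C `&` [set x | x i = Diag]) <= mu (C `&` Diag_at_hit n).
Proof.
move=> i_n dC inf1; have mC := measurable_determined dC.
have mCD : measurable (C `&` [set x | x i = Diag] : set delannoy_space).
  by apply: measurableI => //; exact: measurable_step.
have mG := measurableI _ _ mCD measurable_inf_nonVer.
apply: (@le_trans _ _ (mu (C `&` [set x | x i = Diag] `&` inf_nonVer))).
  rewrite -[leRHS]adde0; apply: (@mu_subU _ mu _ (C `&` [set x | x i = Diag] `&` inf_nonVer)
    (~` inf_nonVer)) => //.
  - by apply: measurableC; exact: measurable_inf_nonVer.
  - by move=> x CDx; have [xi|] := pselect (inf_nonVer x); [left|right].
  - by rewrite inf1.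
apply: (@swap_le _ mu mu_inv (seq step * seq step)%type
  [set sr | size sr.1 = i /\ first_hit n (sr.1 ++ sr.2)]
  (fun sr => rcons sr.1 Diag ++ sr.2) (fun sr => rcons (sr.1 ++ sr.2) Diag)).
- exact: mG.
- by apply: measurableI => //; exact: measurable_Diag_at_hit.
- move=> [s r] _; rewrite /= -!cats1 -!catA !(end_vertex_cat s).
  by rewrite (end_vertex_catC [:: Diag]).
- move=> x [[_ /= xi] x_inf].
  have x_eq : x = path_cat (rcons (mkseq x i) Diag) (path_drop i.+1 x).
    by rewrite -xi -mkseqS path_cat_mkseq.
  pose y := path_drop i.+1 x; pose x' := path_cat (mkseq x i) y.
  have [l hl] : exists l, first_hit n (mkseq x' l).
    apply: first_hit_exists => m; have [k mk xk] := x_inf (i + m.+1)%N.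
    exists k.-1; first by lia.
    rewrite /x' /path_cat size_mkseq; have -> : (k.-1 < i)%N = false by lia.
    by rewrite /y /path_drop; have -> : (i.+1 + (k.-1 - i) = k)%N by lia.
  have il : (i <= l)%N.
    by have := first_hit_size hl; rewrite size_mkseq; lia.
  have x'l : mkseq x' l = mkseq x i ++ mkseq y (l - i).
    rewrite -{1}(subnKC il) mkseq_cat; congr (_ ++ mkseq _ _).
      by rewrite -[in LHS](size_mkseq x i) mkseq_path_cat.
    by rewrite -[in LHS](size_mkseq x i) path_catK.
  exists (mkseq x i, mkseq y (l - i)); first by rewrite /= size_mkseq -x'l.
  apply/cylinderP; exists (path_drop (l - i) y).
  by rewrite /= path_cat_cat path_cat_mkseq; exact: x_eq.
- move=> [s r] y [/= si hsr] [[Cx _] _]; split.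
    apply: dC Cx; rewrite -si -cats1 -!catA [in LHS]path_cat_cat.
    by rewrite -cats1 -catA [in RHS]path_cat_cat !mkseq_path_cat.
  by exists (s ++ r) => //; exact: cylinder_cat.
- move=> [s r] [t q] y z [/= si hsr] [/= ti htq] _ _.
  rewrite !path_cat_rcons => /(first_hit_unique hsr htq)/eqP.
  by rewrite eqseq_cat ?si ?ti // => /andP[/eqP -> /eqP ->].
Qed.

(** The replacement of [Diag] by [Hor], [Ver] at the hitting time maps the part
    of [B] where it applies outside [B], without leaving [C]. *)
Lemma mu_hit_le n i (B C : set delannoy_space) :
  (i <= n)%N -> determined i C -> measurable B ->
  (forall t y, first_hit n t -> B (path_cat (rcons t Diag) y) ->
     ~ B (path_cat (t ++ [:: Hor; Ver]) y)) ->
  mu (C `&` B `&` Diag_at_hit n) <= mu (C `\` B).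
Proof.
move=> i_n dC mB B_swap; have mC := measurable_determined dC.
apply: (@swap_le _ mu mu_inv (seq step) (first_hit n)
  (rcons ^~ Diag) (fun t => t ++ [:: Hor; Ver])).
- by apply: measurableI; [exact: measurableI|exact: measurable_Diag_at_hit].
- exact: measurableD.
- by move=> t _; rewrite -cats1 !end_vertex_cat.
- by move=> x [_ [t ht tx]]; exists t.
- move=> t y ht [[Cx Bx] _]; split; last exact: B_swap.
  apply: dC Cx; apply: (@mkseq_le _ _ _ (size t)).
    exact: leq_trans i_n (first_hit_size ht).
  by rewrite -cats1 !path_cat_cat !mkseq_path_cat.
- move=> s t y z hs ht _ _; rewrite !path_cat_cat; exact: first_hit_unique hs ht.
Qed.

(** If [B] is disjoint from its images under the replacements of [Diag] by
    [Hor], [Ver] at the first hit of arbitrarily large columns, then it is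
    asymptotically disjoint from the event of a diagonal edge at time [i].
    Of the three [e]'s, one is for the part of [B] outside the approximation
    [C], one for the part of [C] outside [B], and one for the image of the rest. *)
Lemma mu_Diag_small (B : set delannoy_space) (e : R) :
  mu (~` inf_nonVer) = 0 -> measurable B ->
  (forall N, exists2 n, (N <= n)%N & forall t y, first_hit n t ->
     B (path_cat (rcons t Diag) y) -> ~ B (path_cat (t ++ [:: Hor; Ver]) y)) ->
  (0 < e)%R ->
  exists N, forall i, (N <= i)%N -> mu (B `&` [set x | x i = Diag]) <= (3 * e)%:E.
Proof.
move=> inf1 mB B_swap e0; have [N [C dC [BC CB]]] := approx_determined mu mB e0.
exists N => i Ni; have {}dC := determined_le Ni dC.
have [n i_n n_swap] := B_swap i.+1; have mC := measurable_determined dC.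
have mD : measurable ([set x | x i = Diag] : set delannoy_space) by exact: measurable_step.
have mH := measurable_Diag_at_hit n.
have mCB : measurable (C `\` B) by exact: measurableD.
have CH : mu (C `&` Diag_at_hit n) <= e%:E + e%:E.
  apply: (@mu_subU _ mu _ (C `\` B) (C `&` B `&` Diag_at_hit n)) => //.
  - exact: measurableI.
  - by apply: measurableI => //; exact: measurableI.
  - by move=> x [Cx Hx]; have [Bx|nB] := pselect (B x); [right|left].
  - by apply: le_trans CB; apply: (@mu_hit_le n i) => //; exact: ltnW.
have -> : (3 * e)%:E = e%:E + (e%:E + e%:E) by rewrite -!EFinD; congr EFin; lra.
apply: (@mu_subU _ mu _ (B `\` C) (C `&` [set x | x i = Diag])) => //.
- exact: measurableI.
- exact: measurableD.
- exact: measurableI.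
- by move=> x [Bx Dx]; have [Cx|nC] := pselect (C x); [right|left].
- exact: le_trans (mu_Diag_le_hit i_n dC inf1) CH.
Qed.

End hit_estimates.

(** * A fundamental domain for multiplication by a root of unity *)

(** The positive cone of the lexicographic order on the complex numbers. *)
Definition lexpos (R : realType) (z : R[i]) : bool :=
  (0 < complex.Re z) || ((complex.Re z == 0) && (0 <= complex.Im z)).

Section lexpos.
Context {R : realType}.
Implicit Types z w : R[i].

Lemma lexpos0 : lexpos (0 : R[i]).
Proof. by rewrite /lexpos /= eqxx lexx orbT. Qed.

Lemma lexposD z w : lexpos z -> lexpos w -> lexpos (z + w).
Proof.
case: z w => [a b] [c d]; rewrite /lexpos /=.
move=> /orP[a0|/andP[/eqP a0 b0]] /orP[c0|/andP[/eqP c0 d0]].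
- by rewrite addr_gt0.
- by rewrite c0 addr0 a0.
- by rewrite a0 add0r c0.
- by rewrite a0 c0 addr0 eqxx addr_ge0 ?orbT.
Qed.

Lemma lexpos_total z : lexpos z || lexpos (- z).
Proof.
case: z => [a b]; rewrite /lexpos /= oppr_gt0 oppr_eq0 oppr_ge0.
by case: (ltgtP a 0) => //= _; exact: le_total.
Qed.

Lemma lexpos_anti z : lexpos z -> lexpos (- z) -> z = 0.
Proof.
case: z => [a b]; rewrite /lexpos /= oppr_gt0 oppr_eq0 oppr_ge0.
by case: (ltgtP a 0) => //= -> b0 b0'; congr (_ +i* _)%C; apply/eqP; rewrite eq_le b0 b0'.
Qed.

(** Every nonempty finite set of complex numbers has a lexicographic maximum. *)
Lemma lexpos_max (z0 : R[i]) (s : seq R[i]) : z0 \in s ->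
  exists2 z, z \in s & {in s, forall w, lexpos (z - w)}.
Proof.
elim: s z0 => // z1 s IHs _ _; case: s IHs => [_|z2 s IHs].
  by exists z1 => [|w]; rewrite ?mem_head // inE => /eqP ->; rewrite subrr lexpos0.
have [z zs z_max] := IHs z2 (mem_head _ _).
have [z_ge|z_le] := orP (lexpos_total (z - z1)).
  exists z => [|w]; first by rewrite inE zs orbT.
  by rewrite inE => /predU1P[->//|]; exact: z_max.
exists z1; first exact: mem_head.
move=> w; rewrite inE => /predU1P[->|/z_max zw]; first by rewrite subrr lexpos0.
by rewrite -[z1 - w](subrKA z) -opprB lexposD.
Qed.

End lexpos.

Section measurable_complex.
Context {R : realType} {d : measure_display} {T : measurableType d}.
Variable f : T -> R[i].
Hypotheses (mRe : measurable_fun setT (fun x => complex.Re (f x)))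
           (mIm : measurable_fun setT (fun x => complex.Im (f x))).

Lemma measurable_complex_eq0 : measurable [set x | f x = 0].
Proof.
rewrite (_ : [set _ | _] = (fun x => complex.Re (f x)) @^-1` [set 0] `&`
                          (fun x => complex.Im (f x)) @^-1` [set 0]).
  by apply: measurableI; rewrite -[X in measurable X]setTI; [apply: mRe|apply: mIm].
apply/seteqP; split=> x /=; first by move=> ->.
by case: (f x) => a b /= [-> ->].
Qed.

Lemma measurable_lexpos (c : R[i]) : measurable [set x | lexpos (c * f x)].
Proof.
pose g x : R := complex.Re c * complex.Re (f x) - complex.Im c * complex.Im (f x).
pose h x : R := complex.Re c * complex.Im (f x) + complex.Im c * complex.Re (f x).
have mg : measurable_fun setT g.
  by apply: measurable_funB; apply: measurable_funM => //; exact: measurable_cst.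
have mh : measurable_fun setT h.
  by apply: measurable_funD; apply: measurable_funM => //; exact: measurable_cst.
have cfE x : c * f x = (g x +i* h x)%C.
  by rewrite /g /h {g h mg mh}; case: c (f x) => [a b] [a' b'] /=.
rewrite (_ : [set _ | _] = g @^-1` `]0, +oo[%classic `|`
   (g @^-1` [set 0] `&` h @^-1` `[0, +oo[%classic)).
  apply: measurableU; last apply: measurableI; rewrite -[X in measurable X]setTI.
  - exact: mg.
  - exact: mg.
  - exact: mh.
apply/seteqP; split=> x /=; rewrite cfE /lexpos /= !in_itv /= !andbT.
  by move=> /orP[->|/andP[/eqP -> ->]]; [left|right].
by move=> [->|[-> ->]]; rewrite ?eqxx ?orbT.
Qed.

End measurable_complex.

(** A root of unity other than [1] has an order with a prime divisor. *)
Lemma root_unity_prime (K : fieldType) (lambda : K) n : (0 < n)%N ->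
  lambda ^+ n = 1 -> lambda != 1 ->
  exists2 p, prime p & forall d, lambda ^+ d = 1 -> (p %| d)%N.
Proof.
move=> n_gt0 ln1 l_neq1; have [m m_prim _] := prim_order_exists n_gt0 ln1.
have m_gt1 : (1 < m)%N.
  have := prim_order_gt0 m_prim; rewrite leq_eqVlt => /predU1P[m1|//].
  by case/eqP: l_neq1; rewrite -[lambda]expr1 m1 prim_expr_order.
exists (pdiv m); first exact: pdiv_prime.
by move=> d /eqP; rewrite -(prim_order_dvd m_prim) => /(dvdn_trans (pdiv_dvd m)).
Qed.

(** * Eigenvalues of finite order *)

Section eigenvalue.
Context {R : realType} (mu : probability delannoy_space R).
Hypotheses (mu_inv : tail_invariant mu) (mu_erg : tail_ergodic mu).

(** The paths without tail equivalent path in [N]. *)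
Definition tail_avoiding (N : set delannoy_path) : set delannoy_path :=
  [set x | forall z, tail_equivalent x z -> ~ N z].

Lemma tail_avoiding_sat N x y : tail_equivalent x y ->
  tail_avoiding N x -> tail_avoiding N y.
Proof. by move=> xy Nx z yz; apply: Nx; exact: tail_equivalent_trans yz. Qed.

(** A null set remains null after saturation by the tail relation. *)
Lemma tail_avoiding_null (N : set delannoy_space) : measurable N -> mu N = 0%E ->
  measurable (tail_avoiding N : set delannoy_space) /\ mu (~` tail_avoiding N) = 0%E.
Proof.
move=> mN N0.
pose P : set (seq step * seq step) := [set uw | end_vertex uw.1 = end_vertex uw.2].
pose A (uw : seq step * seq step) : set delannoy_space :=
  path_cat uw.1 @` (path_cat uw.2 @^-1` N).
have AE : ~` tail_avoiding N = \bigcup_(uw in P) A uw.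
  apply/seteqP; split=> [x nx|x [[u w] /= uw [y Ny <-]] /(_ (path_cat w y))].
    have [[uw Puw Ax]|no] := pselect (exists2 uw, P uw & A uw x); first by exists uw.
    exfalso; apply: nx => z [i [j m_ij]] Nz; apply: no.
    have [x_eq z_eq] := merge_at_catE m_ij.
    exists (mkseq x i, mkseq z j); first by case: m_ij.
    by exists (path_drop i x) => //=; rewrite /preimage /= -z_eq.
  by apply=> //; exact: tail_equivalent_cat.
have mA uw : P uw -> measurable (A uw).
  by move=> _; apply: measurable_image_path_cat; exact: measurable_preimage_path_cat.
split.
  rewrite -[X in measurable X]setCK; apply: measurableC; rewrite AE.
  exact: bigcup_measurable_countType.
rewrite AE mu_bigcup0 // => -[u w] uw.
apply/eqP; rewrite eq_le measure_ge0 andbT /A /=.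
rewrite (mu_path_cat mu_inv uw); last exact: measurable_preimage_path_cat.
rewrite -N0; apply: mu_le => //; last by move=> _ [y Ny <-].
by apply: measurable_image_path_cat; exact: measurable_preimage_path_cat.
Qed.

(** If diagonal edges have probability zero, then so have the two corners
    [Hor], [Ver] and [Ver], [Hor], and almost every path is constant. *)
Lemma Diag_null_const : mu (cylinder [:: Diag]) = 0%E ->
  mu [set (fun=> Hor)] = 0%E -> mu [set (fun=> Ver)] <> 0%E.
Proof.
move=> D0 H0 V0.
pose P : set (seq step * seq step) :=
  [set su | su.2 \in [:: [:: Diag]; [:: Hor; Ver]; [:: Ver; Hor]]].
pose A (su : seq step * seq step) : set delannoy_space := cylinder (su.1 ++ su.2).
have mA su : P su -> measurable (A su) by move=> _; exact: measurable_cylinder.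
have A0 su : P su -> mu (A su) = 0%E.
  case: su => s u /= Pu; have u0 : mu (cylinder u) = 0%E.
    by rewrite -D0; apply: mu_inv; move: Pu; rewrite /P /= !inE => /or3P[] /eqP ->.
  rewrite /A /= (mu_inv (end_vertex_catC s u)).
  apply/eqP; rewrite eq_le measure_ge0 andbT -u0 -image_path_cat_cylinder.
  apply: mu_le; [|exact: measurable_cylinder|].
    by apply: measurable_image_path_cat; exact: measurable_cylinder.
  by move=> _ [y _ <-]; exact: cylinder_cat.
have mUA : measurable (\bigcup_(su in P) A su) by exact: bigcup_measurable_countType.
have mc a : measurable ([set (fun=> a)] : set delannoy_space) := measurable_const_path a.
have : (mu setT <= 0 + (0 + 0))%E.
  apply: (@mu_subU _ mu _ [set (fun=> Hor)] ([set (fun=> Ver)] `|` \bigcup_(su in P) A su)).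
  - exact: measurableT.
  - exact: mc.
  - exact: measurableU.
  - move=> x _; have [UA|nUA] := pselect ((\bigcup_(su in P) A su) x); first by right; right.
    have nP i u : P (mkseq x i, u) -> mkseq x (i + size u) <> mkseq x i ++ u.
      move=> Pu e; apply: nUA; exists (mkseq x i, u) => //.
      by rewrite /A /cylinder /= size_cat size_mkseq.
    have xD i : x i <> Diag.
      move=> xi; apply: (nP i [:: Diag]) => //.
      by rewrite addn1 mkseqS xi cats1.
    have xS i : x i.+1 = x i.
      have := xD i; have := xD i.+1.
      have := nP i [:: x i; x i.+1]; rewrite /= addn2 !mkseqS -!cats1 -catA /=.
      by case: (x i); case: (x i.+1) => // h; case: h.
    have x0 : x = (fun=> x 0%N).
      by apply: funext => i; elim: i => // i IHi; rewrite xS.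
    by have := xD 0%N; case: (x 0%N) x0 => // -> _; [left|right; left].
  - by rewrite H0.
  - apply: (@mu_subU _ mu _ [set (fun=> Ver)] (\bigcup_(su in P) A su)) => //.
    + exact: measurableU.
    + by rewrite V0.
    + by rewrite mu_bigcup0.
by rewrite !adde0 probability_setT lee_fin ler10.
Qed.

(** [B] meets the event of a diagonal edge at time [i] with a probability that
    vanishes as [i] grows. *)
Definition Diag_vanishing (B : set delannoy_path) : Prop :=
  forall e : R, (0 < e)%R -> exists N, forall i, (N <= i)%N ->
    (mu (B `&` [set x | x i = Diag]) <= e%:E)%E.

Lemma Diag_vanishingU (A B : set delannoy_space) : measurable A -> measurable B ->
  Diag_vanishing A -> Diag_vanishing B -> Diag_vanishing (A `|` B).
Proof.
move=> mA mB vA vB e e0; have e20 : 0 < e / 2 by rewrite divr_gt0.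
have [N AN] := vA _ e20; have [M BM] := vB _ e20.
exists (maxn N M) => i; rewrite geq_max => /andP[Ni Mi]; rewrite (splitr e) EFinD.
have mD := measurable_step i Diag.
apply: (@mu_subU _ mu _ (A `&` [set x | x i = Diag]) (B `&` [set x | x i = Diag])).
- by apply: measurableI => //; exact: measurableU.
- exact: measurableI.
- exact: measurableI.
- by move=> x [[Ax|Bx] xi]; [left|right].
- exact: AN.
- exact: BM.
Qed.

Lemma Diag_vanishingT : Diag_vanishing setT -> mu (cylinder [:: Diag]) = 0%E.
Proof.
move=> v; apply/eqP; rewrite eq_le measure_ge0 andbT; apply/lee_addgt0Pr => e e0.
rewrite add0e; have [N /(_ N (leqnn _))] := v e e0; rewrite setTI.
apply: le_trans; apply: le_trans (mu_step0_le mu_inv N Diag).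
rewrite (_ : cylinder _ = [set x | x 0%N = Diag]) //.
by apply/seteqP; split=> x; rewrite /cylinder /mkseq /=; [case|move=> ->].
Qed.

Lemma eigenvalue_eq1 (f : delannoy_space -> R[i]) (lambda : R[i]) (n : nat) :
  measurable_fun setT (fun x => complex.Re (f x)) ->
  measurable_fun setT (fun x => complex.Im (f x)) ->
  ~ {ae mu, forall x, f x = 0} ->
  {ae mu, forall x, f (adic x) = lambda * f x} ->
  (0 < n)%N -> lambda ^+ n = 1 -> lambda = 1.
Proof.
move=> mRe mIm f_neq0 [N [mN N0 fN]] n_gt0 ln1.
have [//|l_neq1] := eqVneq lambda 1; exfalso.
have [p p_pr p_dvd] := root_unity_prime n_gt0 ln1 l_neq1.
have l_neq0 : lambda != 0.
  by apply: contra_eq_neq ln1 => ->; rewrite expr0n gtn_eqF // eq_sym oner_neq0.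
pose Y := tail_avoiding N.
have [mY Y0] := tail_avoiding_null mN N0; rewrite -/Y in mY Y0.
have Y_sat x y : tail_equivalent x y -> Y x -> Y y := @tail_avoiding_sat N x y.
have f_adic x : Y x -> f (adic x) = lambda * f x.
  move=> Yx; apply: contrapT => fx; apply: (Yx x); last exact: fN.
  by exists 0%N, 0%N.
(* By ergodicity, almost every path lies in [Y] and satisfies [f x <> 0]. *)
pose U : set delannoy_space := Y `\` [set x | f x = 0].
have mf0 := measurable_complex_eq0 mRe mIm.
have mU : measurable U by exact: measurableD.
have U_sat : tail_saturated U.
  move=> x y xy [Yx /eqP fx]; split; first exact: Y_sat Yx.
  by apply/eqP; exact: (eigen_neq0 Y_sat f_adic l_neq0 xy Yx fx).
have UC0 : mu (~` U) = 0%E.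
  have [U0|U1] := mu_erg mU U_sat; last by rewrite probability_setC // U1 subee.
  exfalso; apply: f_neq0; exists (U `|` ~` Y); split.
  - by apply: measurableU => //; exact: measurableC.
  - apply/eqP; rewrite eq_le measure_ge0 andbT -[leRHS]adde0.
    apply: (@mu_subU _ mu _ U (~` Y)) => //.
    + by apply: measurableU => //; exact: measurableC.
    + exact: measurableC.
    + by rewrite U0.
    + by rewrite Y0.
  - by move=> x /= fx; have [Yx|nY] := pselect (Y x); [left|right].
have const0 a : a != Diag -> mu [set (fun=> a)] = 0%E.
  move=> aD; apply/eqP; rewrite eq_le measure_ge0 andbT -UC0.
  apply: mu_le; [exact: measurable_const_path|exact: measurableC|].
  move=> _ -> [Ya /= fa]; case/eqP: l_neq1; apply: (mulIf (introN eqP fa)).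
  by rewrite -f_adic // adic_const // mul1r.
(* [lambda ^+ m * f x] is the maximum of the orbit of [f x]. *)
pose B m : set delannoy_space :=
  U `&` \bigcap_l [set x | lexpos ((lambda ^+ m - lambda ^+ l) * f x)].
have mB m : measurable (B m).
  by apply: measurableI => //; apply: bigcapT_measurable => l; exact: measurable_lexpos.
have B_swap m M : exists2 c, (M <= c)%N & forall t y, first_hit c t ->
    B m (path_cat (rcons t Diag) y) -> ~ B m (path_cat (t ++ [:: Hor; Ver]) y).
  exists (p ^ M.+1).-1; first by have := ltn_expl M.+1 (prime_gt1 p_pr); lia.
  move=> t y [t_c _] [[Yx /eqP fx] x_max] [_ x'_max].
  have := delannoy_predpexp M.+1 p_pr (end_vertex t).2.
  have := eigen_Diag Y_sat f_adic Yx; rewrite t_c.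
  set d := delannoy _ _; set x := path_cat _ y in fx x_max *.
  set x' := path_cat _ y in x'_max * => fxx' /negP; apply; apply: p_dvd.
  have ldn : lambda ^+ (d * n.-1) * lambda ^+ d = 1.
    by rewrite -exprD -mulnSr prednK // mulnC exprM ln1 expr1n.
  (* [x] and [x'] have values in the same orbit, and [m] picks its maximum for
     both; the exponent [d * n.-1] inverts [lambda ^+ d]. *)
  have eq_m : lambda ^+ m * f x' = lambda ^+ m * f x.
    apply/eqP; rewrite -subr_eq0; apply/eqP/lexpos_anti.
      have := x'_max (m + d)%N I; rewrite /= mulrBl exprD -[_ * _ * f x']mulrA.
      by rewrite -fxx'.
    have := x_max (m + d * n.-1)%N I; rewrite /= opprB mulrBl exprD.
    by rewrite [in X in _ - X]fxx' mulrA -[_ * _ * lambda ^+ d]mulrA ldn mulr1.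
  have f_eq := mulfI (expf_neq0 m l_neq0) eq_m.
  by apply: (mulIf fx); rewrite mul1r -{1}f_eq -fxx'.
have inf1 := mu_inf_nonVerC mu_inv (const0 Ver isT).
have vB m : Diag_vanishing (B m).
  move=> e e0; have e30 : 0 < e / 3 by rewrite divr_gt0.
  have [M HM] := mu_Diag_small mu_inv inf1 (mB m) (B_swap m) e30.
  by exists M => i /HM; rewrite mulrC divfK.
have vBs k : measurable (\bigcup_(m in [set m | (m < k)%N]) B m) /\
    Diag_vanishing (\bigcup_(m in [set m | (m < k)%N]) B m).
  elim: k => [|k [mBs vBs]].
    have -> : \bigcup_(m in [set m | (m < 0)%N]) B m = set0.
      by rewrite -subset0 => x [].
    split=> // e e0; exists 0%N => i _; rewrite set0I measure0 lee_fin; exact: ltW.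
  have -> : \bigcup_(m in [set m | (m < k.+1)%N]) B m =
      (\bigcup_(m in [set m | (m < k)%N]) B m) `|` B k.
    apply/seteqP; split=> x.
      move=> [m /= ]; rewrite ltnS leq_eqVlt => /predU1P[-> Bx|mk Bx]; first by right.
      by left; exists m.
    by move=> [[m /= mk Bx]|Bx]; [exists m => //=; exact: ltnW|exists k => /=].
  by split; [exact: measurableU|exact: Diag_vanishingU].
have [mBn vBn] := vBs n.
apply: (Diag_null_const _ (const0 Hor isT) (const0 Ver isT)).
apply: Diag_vanishingT.
rewrite (_ : setT = (\bigcup_(m in [set m | (m < n)%N]) B m) `|` ~` U).
  apply: Diag_vanishingU => //; first exact: measurableC.
  move=> e e0; exists 0%N => i _; apply: (@le_trans _ _ 0%E); last by rewrite lee_fin ltW.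
  rewrite -UC0; apply: mu_le; last by move=> x [].
    by apply: measurableI; [exact: measurableC|exact: measurable_step].
  exact: measurableC.
apply/esym/seteqP; split=> // x _.
have [Ux|nU] := pselect (U x); last by right.
left; pose s := [seq lambda ^+ l * f x | l <- iota 0 n].
have in_s l : lambda ^+ l * f x \in s.
  rewrite (divn_eq l n) exprD mulnC exprM ln1 expr1n mul1r.
  by apply: map_f; rewrite mem_iota ltn_mod.
have [z /mapP[m]] := lexpos_max (in_s 0%N).
rewrite mem_iota => /= m_n -> z_max; exists m => //; split=> // l _ /=.
by rewrite mulrBl; apply: z_max.
Qed.

End eigenvalue.

Theorem theorem3p5 (R : realType) (mu : probability delannoy_space R)
  (mu_inv : tail_invariant mu) (mu_erg : tail_ergodic mu) :
  totally_ergodic mu.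
Proof.
move=> lambda [n n_gt0 ln1] [f [[mRe mIm _] f_neq0 f_adic]].
exact: (eigenvalue_eq1 mu_inv mu_erg mRe mIm f_neq0 f_adic n_gt0 ln1).
Qed.
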